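(* Let $G$ be a locally compact abelian group with dual group $\hat G$, let $\mu\in M_d(G)$, let $K\subset\mathbb{C}$ be a compact set, and let $h$ be a complex-valued function that is real-analytic on an open neighborhood of $K$. Then there is a measure $\nu\in M_d(G)$ such that $\hat\nu(y)=h(\hat\mu(y))$ for every $y\in\hat G$ for which $\hat\mu(y)\in K$, and such that $\operatorname{supp}\nu\subset\operatorname{Lin}_{\mathbb{Z}}\operatorname{supp}\mu$.
   Context: $M_d(G)$ is the set of pure point complex measures on $G$ of finite total variation, i.e. measures $\mu=\sum_n a_n\delta_{\gamma_n}$ with (countably many) $\gamma_n\in G$ and $\sum_n|a_n|<\infty$, where $\delta_s$ is the unit mass at $s$. For $\mu\in M_d(G)$, $\operatorname{supp}\mu$ denotes the set $\{x\in G:\mu(\{x\})\neq 0\}$ (no closure is taken), and $\operatorname{Lin}_{\mathbb{Z}}E$ denotes the set of all finite integer linear combinations of elements of $E\subset G$, i.e. the subgroup of $G$ generated by $E$. $\hat G$ is the group of (continuous unitary) characters of $G$, $(x,y)$ is the value of the character $y\in\hat G$ at $x\in G$, and the Fourier transform is $\hat\mu(y)=\int_G(-x,y)\,\mu(dx)$, $y\in\hat G$; thus $\hat\mu(y)=\sum_n a_n(-\gamma_n,y)$ for $\mu=\sum_n a_n\delta_{\gamma_n}$. A complex-valued function $h$ on an open set $V\subset\mathbb{C}$ is real-analytic on $V$ if for every $z\in V$ there are $r_z>0$ and coefficients $c_{k,n}\in\mathbb{C}$ such that $h(\xi+i\eta)=\sum_{k,n=0}^\infty c_{k,n}(\xi-\operatorname{Re}z)^k(\eta-\operatorname{Im}z)^n$,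 the series converging for all real $\xi,\eta$ with $|\xi-\operatorname{Re}z|^2+|\eta-\operatorname{Im}z|^2<r_z^2$. *)

(* Defs.v *)
(* [R : realType] is arbitrary, and [R[i]] is the field of complex numbers
   over [R]. *)
From HB Require Import structures.
From mathcomp Require Import all_boot all_order all_algebra.
From mathcomp Require Import all_classical all_reals all_analysis.
From mathcomp.real_closed Require Import complex.

Set Implicit Arguments.
Unset Strict Implicit.
Unset Printing Implicit Defensive.

Import Order.TTheory GRing.Theory Num.Theory.
Import numFieldNormedType.Exports.

Local Open Scope classical_set_scope.
Local Open Scope ring_scope.
Local Open Scope complex_scope.

(* The norm topology of the complex plane: the libraries provide it on the
   alias [R[i]^o] only. *)
HB.instance Definition _ (R : realType) := NormedModule.copy R[i] R[i]^o.

(* [G] with its Borel sigma-algebra; going through [zmodType] makes the type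
   pointed (at 0), as [g_sigma_algebraType] requires. *)
Definition borel (G : topologicalZmodType) :=
  @g_sigma_algebraType (G : zmodType) (@open G).

(* A complex measure is given by its real and imaginary parts, which are finite
   signed measures (library charges only take finite values). *)
Record complex_measure d (T : measurableType d) (R : realType) := ComplexMeasure {
  re_charge : {charge set T -> \bar R};
  im_charge : {charge set T -> \bar R} }.

Definition cmeas d (T : measurableType d) (R : realType)
    (mu : complex_measure T R) (A : set T) : R[i] :=
  fine (re_charge mu A) +i* fine (im_charge mu A).

Section integral.
Context d (T : measurableType d) (R : realType).

(* A choice of Hahn decomposition; the Jordan decomposition, hence the integral
   below, does not depend on it. *)
Definition hahn_pos (nu : {charge set T -> \bar R}) : set T :=
  sval (cid (Hahn_decomposition nu)).

Definition hahn_neg (nu : {charge set T -> \bar R}) : set T :=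
  sval (cid (svalP (cid (Hahn_decomposition nu)))).

Lemma hahn_pos_neg (nu : {charge set T -> \bar R}) :
  hahn_decomposition nu (hahn_pos nu) (hahn_neg nu).
Proof. exact: (svalP (cid (svalP (cid (Hahn_decomposition nu))))). Qed.

Definition charge_integral (nu : {charge set T -> \bar R}) (f : T -> R) : R :=
  \int[jordan_pos (hahn_pos_neg nu)]_x f x
  - \int[jordan_neg (hahn_pos_neg nu)]_x f x.

Definition complex_integral (mu : complex_measure T R) (f : T -> R[i]) : R[i] :=
  let re_f := fun x => complex.Re (f x) in
  let im_f := fun x => complex.Im (f x) in
  (charge_integral (re_charge mu) re_f - charge_integral (im_charge mu) im_f)
  +i* (charge_integral (re_charge mu) im_f
       + charge_integral (im_charge mu) re_f).

End integral.

Section discrete_measures.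
Context (R : realType) (G : topologicalZmodType).

(* [M_d G]. The atoms need not be pairwise distinct and the [a n] may vanish, so
   that finite sums are included. *)
Definition M_d : set (complex_measure (borel G) R) :=
  [set mu | exists (a : nat -> R[i]) (g : nat -> G),
    cvgn [normed series a] /\
    forall A : set (borel G), measurable A ->
      series (fun n => a n * \1_A (g n)) @ \oo --> cmeas mu A].

Definition supp (mu : complex_measure (borel G) R) : set G :=
  [set x | cmeas mu [set x] != 0].

(* The underlying set of the dual group of [G]. *)
Definition dual : set (G -> R[i]) :=
  [set y : G -> R[i] | [/\ continuous y, forall x, `|y x| = 1
                         & forall x1 x2, y (x1 + x2) = y x1 * y x2]].

Definition fourier (mu : complex_measure (borel G) R) (y : G -> R[i]) : R[i] :=
  complex_integral mu (fun x => y (- x)).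

End discrete_measures.

Definition LinZ (G : zmodType) (E : set G) : set G :=
  [set x | exists (n : nat) (c : 'I_n -> int) (e : 'I_n -> G),
    (forall i, E (e i)) /\ x = \sum_(i < n) e i *~ c i].

Section real_analytic.
Context (R : realType).

(* The double series of the [u k n] converges, absolutely, to [s]; by absolute
   convergence the square partial sums may be replaced by those along any other
   exhaustion of the index set. *)
Definition double_series_cvg (u : nat -> nat -> R[i]) (s : R[i]) :=
  summable [set: nat * nat] (fun p => (complex.Re `|u p.1 p.2|)%:E) /\
  (fun N => \sum_(k < N) \sum_(n < N) u k n) @ \oo --> s.

(* [h] is a total function, but only its values on [V] matter when [V] is
   open: the radius [r] may always be decreased. *)
Definition real_analytic (V : set R[i]) (h : R[i] -> R[i]) :=
  forall z, V z -> exists (r : R) (c : nat -> nat -> R[i]), 0 < r /\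
    forall xi eta : R,
      (xi - complex.Re z) ^+ 2 + (eta - complex.Im z) ^+ 2 < r ^+ 2 ->
      double_series_cvg
        (fun k n => c k n * ((xi - complex.Re z) ^+ k
                             * (eta - complex.Im z) ^+ n)%:C)
        (h (xi +i* eta)).

End real_analytic.

(* Main.v *)
(** The Fourier transforms of the measures in [M_d G] carried by a subgroup form
    an algebra of absolutely convergent series [y |-> sum_n a_n y(g_n)] with
    the norm [sum_n |a_n|].  Split [mu^] into a finite sum of terms
    [a_n y(g_n)] and a remainder of small norm.  On the part of the dual where
    each of the finitely many values [y(g_n)] lies in a short arc centred at
    [z_n], the function [y(g_n) - z_n] coincides with an element of small norm;
    hence so does [mu^ - z], up to a constant, and substituting its real and
    imaginary parts in an expansion of [h] yields an element of the algebra.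
    The local solutions are glued with functions of the algebra which are equal
    to [1] on an arc and vanish outside of a larger one.

    Both the windows and the local elements of small norm come from the power
    series of [asin], which is absolutely convergent at [1]: composed with
    [cos], it puts the triangle wave in the algebra, linear combinations of
    translates of which give trapezoids, and [asin (sin (m t)) / m] is equal to
    [t] for [|t| <= pi / (2 m)], with norm at most [pi / (2 m)]. *)
From HB Require Import structures.
Require Import Defs.
From mathcomp Require Import all_boot all_order all_algebra.
From mathcomp Require Import all_classical all_reals all_analysis.
From mathcomp Require Import measurable_realfun.
From mathcomp.real_closed Require Import complex.
From mathcomp Require Import ring lra zify.
Import Order.TTheory GRing.Theory Num.Theory.
Import numFieldNormedType.Exports.
Import ComplexField.Normc.
Local Open Scope classical_set_scope.
Local Open Scope ring_scope.
Local Open Scope complex_scope.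

Set Implicit Arguments.
Unset Strict Implicit.
Unset Printing Implicit Defensive.

(** * Limits and double series of complex numbers *)

Section Normc.
Context {R : realType}.
Implicit Types x y z : R[i].

Lemma normr_normc z : `|z| = (normc z)%:C.
Proof. by case: z => a b; rewrite normc_def. Qed.

Lemma normc_ge0 z : 0 <= normc z.
Proof. by case: z => a b; exact: sqrtr_ge0. Qed.

Lemma ler_normcD x y : normc (x + y) <= normc x + normc y.
Proof. exact: le_normcD. Qed.

Lemma normcNE z : normc (- z) = normc z.
Proof. exact: normcN. Qed.

Lemma normc_distC x y : normc (x - y) = normc (y - x).
Proof. by rewrite -normcNE opprB. Qed.

Lemma ler_normcB x y : normc (x - y) <= normc x + normc y.
Proof. by rewrite -[normc y]normcNE ler_normcD. Qed.

Lemma ler_dist_normcD z x y : normc (x - y) <= normc (x - z) + normc (z - y).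
Proof. by rewrite -[x - y](subrKA z) ler_normcD. Qed.

Lemma normc_real (a : R) : normc a%:C = `|a|.
Proof. by rewrite /normc /= expr0n addr0 sqrtr_sqr. Qed.

Lemma normcX z n : normc (z ^+ n) = normc z ^+ n.
Proof.
elim: n => [|n IHn]; first by rewrite !expr0 normc1.
by rewrite !exprS normcM IHn.
Qed.

Lemma normc_conj z : normc z^* = normc z.
Proof. by case: z => a b /=; rewrite sqrrN. Qed.

Lemma normc_Re z : `|complex.Re z| <= normc z.
Proof.
case: z => a b /=; rewrite -[X in X <= _]sqrtr_sqr ler_wsqrtr//.
by rewrite lerDl sqr_ge0.
Qed.

Lemma normc_Im z : `|complex.Im z| <= normc z.
Proof.
case: z => a b /=; rewrite -[X in X <= _]sqrtr_sqr ler_wsqrtr//.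
by rewrite lerDr sqr_ge0.
Qed.

Lemma normc_le_ReIm z : normc z <= `|complex.Re z| + `|complex.Im z|.
Proof.
case: z => a b /=; rewrite -[leRHS]ger0_norm ?addr_ge0// -[leRHS]sqrtr_sqr.
rewrite ler_wsqrtr// sqrrD !real_normK ?num_real// lerD2r lerDl.
by rewrite mulrn_wge0// mulr_ge0.
Qed.

Lemma ler_normc_sum I (r : seq I) (P : pred I) (F : I -> R[i]) :
  normc (\sum_(i <- r | P i) F i) <= \sum_(i <- r | P i) normc (F i).
Proof.
elim/big_rec2: _ => [|i y x _ IH]; first by rewrite normc0.
by rewrite (le_trans (ler_normcD _ _))// lerD2l.
Qed.

End Normc.

Section Tends.
Context {R : realType}.
Implicit Types (u v : nat -> R[i]) (s t : R[i]).

(** Convergence with a real tolerance, whereas the topology of [R[i]] quantifies over positive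
    elements of [R[i]] itself. *)
Definition tends u s := forall e : R, 0 < e ->
  exists N, forall n, (N <= n)%N -> normc (u n - s) <= e.

Lemma tends_cvg u s : u @ \oo --> s <-> tends u s.
Proof.
split=> [/cvgrPdist_le us e e0|us].
  have eC : 0 < e%:C by rewrite ltcR.
  have [N _ Ns] := us _ eC.
  by exists N => n /Ns; rewrite normr_normc lecR normc_distC.
apply/cvgrPdist_le => e e0.
(* A positive element of [R[i]] is real, so the tolerance reduces to a real one. *)
have Ime : complex.Im e = 0 by apply: ger0_Im; rewrite ltW.
have eE : e = (complex.Re e)%:C.
  by rewrite [LHS]complexE Ime rmorph0 mulr0 addr0.
rewrite {}eE ltcR in e0 *.
have [N Ns] := us _ e0.
by exists N => // n /Ns; rewrite normr_normc lecR normc_distC.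
Qed.

Lemma tends_cst s : tends (fun=> s) s.
Proof. by move=> e e0; exists 0%N => n _; rewrite subrr normc0 ltW. Qed.

Lemma tends_near u v s N : (forall n, (N <= n)%N -> u n = v n) ->
  tends u s -> tends v s.
Proof.
move=> uv us e /us[M Ms]; exists (maxn N M) => n.
by rewrite geq_max => /andP[/uv <- /Ms].
Qed.

Lemma tends_ext u v s : u =1 v -> tends u s -> tends v s.
Proof. by move=> uv; apply: (@tends_near _ _ _ 0%N). Qed.

Lemma tendsD u v s t : tends u s -> tends v t ->
  tends (fun n => u n + v n) (s + t).
Proof.
move=> us vt e e0; have e2 : 0 < e / 2 by rewrite divr_gt0.
have [[N Ns] [M Ms]] := (us _ e2, vt _ e2).
exists (maxn N M) => n; rewrite geq_max => /andP[/Ns us' /Ms vt'].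
rewrite opprD addrACA (le_trans (ler_normcD _ _))//.
by rewrite (splitr e) lerD.
Qed.

Lemma tendsMl (c : R[i]) u s : tends u s -> tends (fun n => c * u n) (c * s).
Proof.
move=> us e e0.
have c0 : 0 < normc c + 1 by rewrite ltr_wpDl ?normc_ge0.
have [N Ns] := us _ (divr_gt0 e0 c0).
exists N => n /Ns us'; rewrite -mulrBr normcM.
rewrite ler_pdivlMr// mulrC in us'; apply: le_trans us'.
by rewrite ler_wpM2r ?normc_ge0// lerDl.
Qed.

Lemma tendsB u v s t : tends u s -> tends v t ->
  tends (fun n => u n - v n) (s - t).
Proof.
move=> us /(tendsMl (-1)) vt; rewrite -[- t]mulN1r.
by apply: tends_ext (tendsD us vt) => n; rewrite mulN1r.
Qed.

Lemma tends_conj u s : tends u s -> tends (fun n => (u n)^*) s^*.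
Proof.
by move=> us e /us[N Ns]; exists N => n /Ns; rewrite -rmorphB normc_conj.
Qed.

Lemma tends_normc_le u s N (B : R) : (forall n,
  (N <= n)%N -> normc (u n) <= B) ->
  tends u s -> normc s <= B.
Proof.
move=> uB us; apply/ler_addgt0Pr => e /us[M Ms].
have /Ms us' := leq_maxr N M.
have /uB uB' := leq_maxl N M.
have -> : s = u (maxn N M) - (u (maxn N M) - s) by rewrite opprB addrC subrK.
by rewrite (le_trans (ler_normcB _ _))// lerD.
Qed.

Lemma tends_uniq u s t : tends u s -> tends u t -> s = t.
Proof.
move=> us ut; apply/eqP; rewrite -subr_eq0; apply/eqP.
apply: eq0_normc; apply/eqP.
rewrite eq_le normc_ge0 andbT.
apply: (@tends_normc_le (fun=> 0) _ 0%N) => [n _|]; first by rewrite normc0.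
by apply: tends_ext (tendsB us ut) => n; rewrite subrr.
Qed.

Lemma tends_sum I (r : seq I) (u : I -> nat -> R[i]) (s : I -> R[i]) :
  (forall i, tends (u i) (s i)) ->
  tends (fun n => \sum_(i <- r) u i n) (\sum_(i <- r) s i).
Proof.
move=> us; elim: r => [|i r IH].
  by rewrite big_nil; apply: tends_ext (tends_cst _) => n; rewrite big_nil.
rewrite big_cons; apply: tends_ext (tendsD (us i) IH) => n.
by rewrite big_cons.
Qed.

Lemma tends_real (u : nat -> R) (s : R) :
  u @ \oo --> s -> tends (fun n => (u n)%:C) s%:C.
Proof.
move=> /cvgrPdist_le us e /us[N _ Ns]; exists N => n /Ns.
by rewrite -rmorphB normc_real distrC.
Qed.

End Tends.

(** * Absolutely summable double series and their rearrangements *)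

Section DoubleSeries.
Context {R : realType}.

(** Take for [N] an index at which [W] is within [e] of its supremum. *)
Lemma bounded_nondecreasing_tail (W : nat -> R) (B e : R) : 0 < e ->
  {homo W : m n / (m <= n)%N >-> m <= n} -> (forall n, W n <= B) ->
  exists N, forall n, (N <= n)%N -> W n <= W N + e.
Proof.
move=> e0 ndW WB.
have supW : has_sup (range W).
  by split; [exists (W 0%N), 0%N | exists B => _ [n _ <-]].
have [_ [N _ <-] WN] := sup_adherent e0 supW.
exists N => n _; rewrite -lerBlDr (le_trans _ (ltW WN))// lerD2r.
by apply: ub_le_sup; [exact: supW.2 | exists n].
Qed.

(** Both differences are sums over the elements of [s'] outside of [s], so this is the triangle
    inequality. It reduces the comparison of partial sums over nested index sets to that of their
    absolute masses. *)
Lemma normc_sumB_subset (T : eqType) (u : T -> R[i]) (s s' : seq T) :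
  uniq s -> uniq s' -> {subset s <= s'} ->
  normc (\sum_(p <- s') u p - \sum_(p <- s) u p)
    <= \sum_(p <- s') normc (u p) - \sum_(p <- s) normc (u p).
Proof.
move=> us us' ss'.
have ps' : perm_eq s' (s ++ seq.filter (predC (mem s)) s').
  apply: uniq_perm => //.
    rewrite cat_uniq us filter_uniq// andbT; apply/hasPn => x.
    by rewrite mem_filter => /andP[].
  move=> x; rewrite mem_cat mem_filter /=.
  by case: (boolP (x \in s)) => // /ss' ->.
rewrite !(perm_big _ ps') /= !big_cat /= !(addrC (\sum_(p <- s) _)) !addrK.
exact: ler_normc_sum.
Qed.

Definition square_sum (V : nmodType) (u : nat -> nat -> V) N :=
  \sum_(i < N) \sum_(j < N) u i j.

Definition square_seq N := [seq (i, j) | i <- iota 0 N, j <- iota 0 N].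

Lemma square_sumE (V : nmodType) (u : nat -> nat -> V) N :
  square_sum u N = \sum_(p <- square_seq N) u p.1 p.2.
Proof.
rewrite big_allpairs_dep /square_sum.
rewrite -(big_mkord predT (fun i => \sum_(j < N) u i j)) /index_iota subn0.
apply: eq_bigr => i _.
by rewrite -(big_mkord predT (u i)) /index_iota subn0.
Qed.

Lemma square_seq_uniq N : uniq (square_seq N).
Proof. by apply: allpairs_uniq; rewrite ?iota_uniq// => -[? ?] [? ?]. Qed.

Lemma mem_square_seq N p :
  (p \in square_seq N) = (p.1 < N)%N && (p.2 < N)%N.
Proof.
case: p => i j; apply/allpairsP/andP => /= [[q [] ]|[iN jN]].
  by rewrite !mem_iota !add0n /= => q1 q2 [-> ->].
by exists (i, j); rewrite !mem_iota.
Qed.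

(* The partial sums of [u] enumerated along the canonical injection of
   [nat * nat] into [nat], which need not be surjective. *)
Definition enum_pairs (V : nmodType) (u : nat -> nat -> V) (k : nat) : V :=
  if pickle_inv k is Some p then u p.1 p.2 else 0.

Definition pairs_below n := pmap (@pickle_inv (nat * nat)%type) (iota 0 n).

Lemma enum_pairsE (V : nmodType) (u : nat -> nat -> V) n :
  \sum_(k < n) enum_pairs u k = \sum_(p <- pairs_below n) u p.1 p.2.
Proof.
rewrite -(big_mkord predT (enum_pairs u)) /index_iota subn0 /pairs_below.
elim: (iota 0 n) => [|k r IH]; first by rewrite !big_nil.
rewrite big_cons IH /enum_pairs /=.
by case: pickle_inv => [p|] /=; rewrite ?add0r ?big_cons.
Qed.

Lemma pairs_below_uniq n : uniq (pairs_below n).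
Proof.
by apply: (pmap_uniq (@pickle_invK (nat * nat)%type)); exact: iota_uniq.
Qed.

Lemma mem_pairs_below n p : (p \in pairs_below n) = (pickle p < n)%N.
Proof.
rewrite /pairs_below mem_pmap; apply/mapP/idP => [[k]|pn].
  rewrite mem_iota add0n /= => kn pk.
  by have := @pickle_invK (nat * nat)%type k; rewrite -pk /= => ->.
by exists (pickle p); rewrite ?mem_iota// pickleK_inv.
Qed.

Lemma pairs_below_square n :
  exists N, {subset pairs_below n <= square_seq N}.
Proof.
(* A crude side length: the sum exceeds both coordinates of each of its pairs. *)
exists (\sum_(p <- pairs_below n) (p.1 + p.2).+1)%N => p pn.
rewrite mem_square_seq (big_rem p)//=; apply/andP; split; lia.
Qed.

Lemma square_pairs_below N :
  exists n, {subset square_seq N <= pairs_below n}.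
Proof.
exists (\sum_(p <- square_seq N) (pickle p).+1)%N => p pn.
by rewrite mem_pairs_below (big_rem p)//= leq_addr.
Qed.

Lemma square_sum_homo (u : nat -> nat -> R) : (forall i j, 0 <= u i j) ->
  {homo square_sum u : m n / (m <= n)%N >-> m <= n}.
Proof.
move=> u0 m n mn; rewrite /square_sum.
rewrite -!(big_mkord predT (fun i => \sum_(j < _) u i j)).
rewrite (big_cat_nat _ mn)//= ler_wpDr//.
  by rewrite sumr_ge0// => i _; rewrite sumr_ge0.
apply: ler_sum => i _; rewrite -!(big_mkord predT (u i)).
by rewrite (big_cat_nat _ mn)//= ler_wpDr// sumr_ge0.
Qed.

Section AbsolutelySummable.
Variables (u : nat -> nat -> R[i]) (B : R).
Hypothesis uB : forall N, square_sum (fun i j => normc (u i j)) N <= B.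

Let W := square_sum (fun i j => normc (u i j)).

Let ndW : {homo W : m n / (m <= n)%N >-> m <= n}.
Proof. by apply: square_sum_homo => i j; exact: normc_ge0. Qed.

Let W_tail e : 0 < e -> exists N, forall n, (N <= n)%N -> W n <= W N + e.
Proof. by move=> e0; exact: bounded_nondecreasing_tail e0 ndW uB. Qed.

Let WE n : \sum_(p <- square_seq n) normc (u p.1 p.2) = W n.
Proof. by rewrite /W square_sumE. Qed.

Lemma enum_pairs_normc_le n : \sum_(k < n) normc (enum_pairs u k) <= B.
Proof.
have -> : \sum_(k < n) normc (enum_pairs u k) =
          \sum_(k < n) enum_pairs (fun i j => normc (u i j)) k.
  apply: eq_bigr => k _; rewrite /enum_pairs; case: pickle_inv => //.
  exact: normc0.
rewrite enum_pairsE.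
have [N Nn] := pairs_below_square n.
apply: le_trans (uB N); rewrite square_sumE.
have := @normc_sumB_subset _ (fun p => u p.1 p.2) _ _ (pairs_below_uniq n)
  (square_seq_uniq N) Nn.
by move=> /(le_trans (normc_ge0 _)); rewrite subr_ge0.
Qed.

(** The absolute mass outside of a large square is at most [e / 2]. Hence a segment of the
    enumeration that contains this square has a sum within [e / 2] of the sum over the square,
    itself within [e / 2] of [s]. *)
Lemma tends_enum_pairs s : tends (square_sum u) s ->
  tends (fun n => \sum_(k < n) enum_pairs u k) s.
Proof.
move=> us e e0; have e2 : 0 < e / 2 by rewrite divr_gt0.
have [N WN] := W_tail e2.
have [n0 Nn0] := square_pairs_below N.
have Ns : normc (square_sum u N - s) <= e / 2.
  rewrite normc_distC; apply: (@tends_normc_le _ (fun n =>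
    square_sum u n - square_sum u N) _ N).
    move=> n Nn; rewrite !square_sumE.
    apply: le_trans (normc_sumB_subset _ (square_seq_uniq _) (square_seq_uniq _)
      _) _.
      move=> p; rewrite !mem_square_seq => /andP[p1 p2].
      by rewrite (leq_trans p1)//= (leq_trans p2).
    have := WN _ Nn; rewrite /W !square_sumE /=; lra.
  exact: tendsB us (tends_cst _).
exists n0 => n n0n.
apply: le_trans (ler_dist_normcD (square_sum u N) _ _) _.
rewrite (splitr e) lerD//.
rewrite enum_pairsE square_sumE.
apply: le_trans (normc_sumB_subset _ (square_seq_uniq _) (pairs_below_uniq _) _)
  _.
  move=> p /Nn0; rewrite !mem_pairs_below => /leq_trans; exact.
have [M nM] := pairs_below_square n.
have := @normc_sumB_subset _ (fun p => u p.1 p.2) _ _ (pairs_below_uniq n)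
  (square_seq_uniq M) nM.
move=> /(le_trans (normc_ge0 _)); rewrite subr_ge0.
have := WN _ (leq_maxl N M); have := ndW (leq_maxr N M).
rewrite -!WE; lra.
Qed.

Variable s_ : nat -> R[i].
Hypothesis us_ : forall i, tends (fun n => \sum_(j < n) u i j) (s_ i).

(** Cut the first [n] rows at a common column [K >= n], at a cost of at most [e / n.+1] in each;
    what remains lies in the square of side [K]. *)
Lemma rows_normc_le n : \sum_(i < n) normc (s_ i) <= B.
Proof.
apply/ler_addgt0Pr => e e0.
have en : 0 < e / n.+1%:R by rewrite divr_gt0.
have /choice[M uM] := fun i => us_ i en.
pose K := (n + \sum_(i < n) M i)%N.
have MK (i : 'I_n) : (M i <= K)%N.
  by rewrite /K (bigD1 i)//= addnCA leq_addr.
apply: (@le_trans _ _ (\sum_(i < n) (\sum_(j < K) normc (u i j) + e /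
  n.+1%:R))).
  apply: ler_sum => i _; rewrite -lerBlDr.
  rewrite (le_trans _ (ler_normc_sum _ _ _))//.
  have /uM := MK i; set S := \sum_(j < _) _ => Si.
  have -> : s_ i = S - (S - s_ i) by rewrite opprB addrC subrK.
  by rewrite lerBlDr (le_trans (ler_normcB _ _))// lerD2l.
rewrite big_split /= sumr_const card_ord lerD//.
  apply: le_trans (uB K); rewrite /square_sum.
  rewrite -!(big_mkord predT (fun i => \sum_(j < _) normc (u i j))).
  rewrite (@big_cat_nat _ _ _ n _ K)//=; last by rewrite leq_addr.
  rewrite lerDl sumr_ge0// => i _; rewrite sumr_ge0// => j _.
  exact: normc_ge0.
rewrite -[leLHS]mulr_natr -mulrA ler_piMr ?(ltW e0)// mulrC ler_pdivrMr
  ?ltr0n//.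
by rewrite mul1r ler_nat.
Qed.

(** The difference is the sum of the entries of the first [n] rows from column [n] on. These lie
    outside of the square of side [n], where little absolute mass is left. *)
Lemma tends_rows_square :
  tends (fun n => \sum_(i < n) s_ i - square_sum u n) 0.
Proof.
move=> e /W_tail[N WN]; exists N => n Nn; rewrite subr0.
apply: (@tends_normc_le _
  (fun m => \sum_(i < n) \sum_(j < m) u i j - square_sum u n) _ n).
  move=> m nm.
  have -> : \sum_(i < n) \sum_(j < m) u i j - square_sum u n =
      \sum_(i < n) \sum_(n <= j < m) u i j.
    rewrite /square_sum -sumrB; apply: eq_bigr => i _.
    rewrite -!(big_mkord predT (u i)).
    by rewrite (@big_cat_nat _ _ _ n _ m)//= addrAC subrr add0r.
  apply: (@le_trans _ _ (\sum_(i < n) \sum_(n <= j < m) normc (u i j))).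
    apply: le_trans (ler_normc_sum _ _ _) _; apply: ler_sum => i _.
    exact: ler_normc_sum.
  have W1 := WN _ (leq_trans Nn nm); have W2 := ndW Nn.
  have : W n + \sum_(i < n) \sum_(n <= j < m) normc (u i j) <= W m.
    rewrite /W /square_sum -big_split /=.
    rewrite -(big_mkord predT (fun i => \sum_(j < m) normc (u i j))).
    rewrite (@big_cat_nat _ _ _ n _ m)//= big_mkord ler_wpDr//.
      by rewrite sumr_ge0// => i _; rewrite sumr_ge0// => j _; exact: normc_ge0.
    apply: ler_sum => i _.
    rewrite -!(big_mkord predT (fun j => normc (u i j))).
    by rewrite [leRHS](@big_cat_nat _ _ _ n _ m).
  lra.
by apply: tendsB (tends_cst _); exact: tends_sum.
Qed.

Lemma tends_square_rows s : tends (square_sum u) s <->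
  tends (fun n => \sum_(i < n) s_ i) s.
Proof.
split=> us.
  have := tendsD us tends_rows_square; rewrite addr0; apply: tends_ext => n.
  by rewrite addrC subrK.
have := tendsB us tends_rows_square; rewrite subr0; apply: tends_ext => n.
by rewrite opprB addrC subrK.
Qed.

End AbsolutelySummable.
End DoubleSeries.

(** * The algebra of absolutely convergent Fourier series *)

Section Characters.
Context {R : realType} {G : topologicalZmodType}.
Implicit Types y : G -> R[i].

Lemma dual_normc y x : dual y -> normc (y x) = 1.
Proof. by case=> _ y1 _; apply: complexI; rewrite -normr_normc y1. Qed.

Lemma dualD y x x' : dual y -> y (x + x') = y x * y x'.
Proof. by case. Qed.

Lemma dual0 y : dual y -> y 0 = 1.
Proof.
move=> yD; have y0 : y 0 != 0.
  apply/eqP => y0; have := dual_normc 0 yD.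
  by rewrite y0 normc0 => /eqP; rewrite eq_sym oner_eq0.
by apply: (mulfI y0); rewrite -dualD// addr0 mulr1.
Qed.

Lemma mulc_conj (z : R[i]) : z * z^* = (normc z ^+ 2)%:C.
Proof.
case: z => a b /=; rewrite sqr_sqrtr ?addr_ge0 ?sqr_ge0//.
by apply/eqP; rewrite eq_complex /= !expr2 mulrN opprK mulrN [b * a]mulrC addNr
  !eqxx.
Qed.

Lemma dualN y x : dual y -> y (- x) = (y x)^*.
Proof.
move=> yD; have yx0 : y x != 0.
  apply/eqP => yx0; have := dual_normc x yD.
  by rewrite yx0 normc0 => /eqP; rewrite eq_sym oner_eq0.
by apply: (mulfI yx0);
  rewrite -dualD// subrr dual0// mulc_conj dual_normc// expr1n.
Qed.

Lemma dualMn y x n : dual y -> y (x *+ n) = y x ^+ n.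
Proof.
by move=> yD; elim: n => [|n IH];
  rewrite ?mulr0n ?dual0// mulrS dualD// IH exprS.
Qed.

End Characters.

Section AbsoluteFourierSeries.
Context {R : realType} {G : topologicalZmodType} (S : set G).
Hypotheses (S0 : S 0) (SD : forall x x', S x -> S x' -> S (x + x'))
  (SN : forall x, S x -> S (- x)).
Implicit Types (f h : (G -> R[i]) -> R[i]) (r : R) (c : R[i]).

(* [f] coincides on the dual of [G] with the Fourier transform of a discrete
   measure of total variation at most [r] carried by [- S]. *)
Definition fourier_series r f := exists (a : nat -> R[i]) (g : nat -> G),
  [/\ forall n, S (g n), forall n, \sum_(i < n) normc (a i) <= r
    & forall y, dual y -> tends (fun n => \sum_(i < n) a i * y (g i)) (f y)].

Lemma fourier_series_ext r f h : (forall y, dual y -> f y = h y) ->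
  fourier_series r f -> fourier_series r h.
Proof.
move=> fh [a [g [Sg ar af]]]; exists a, g; split=> // y yD.
by rewrite -fh//; exact: af.
Qed.

Lemma fourier_series_le r r' f : r <= r' ->
  fourier_series r f -> fourier_series r' f.
Proof.
move=> rr' [a [g [Sg ar af]]]; exists a, g; split=> // n.
exact: le_trans rr'.
Qed.

Lemma fourier_series_ge0 r f : fourier_series r f -> 0 <= r.
Proof. by move=> [a [g [_ ar _]]]; have := ar 0%N; rewrite big_ord0. Qed.

Lemma fourier_series_normc r f y : fourier_series r f -> dual y ->
  normc (f y) <= r.
Proof.
move=> [a [g [_ ar af]]] yD;
  apply: (@tends_normc_le _ _ _ 0%N) (af y yD) => n _.
apply: le_trans (ler_normc_sum _ _ _) (le_trans _ (ar n)).
by apply: ler_sum => i _; rewrite normcM dual_normc// mulr1.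
Qed.

Lemma fourier_series_char c x : S x -> fourier_series (normc c) (fun y =>
  c * y x).
Proof.
move=> Sx; exists (fun n => if n is 0 then c else 0), (fun=> x); split=> //.
  move=> [|n]; first by rewrite big_ord0 normc_ge0.
  rewrite big_ord_recl /= big1 ?addr0// => i _.
  exact: normc0.
move=> y yD; apply: (@tends_near _ (fun=> c * y x) _ _ 1) (tends_cst _).
move=> [//|n] _; rewrite big_ord_recl /= big1 ?addr0// => i _.
by rewrite mul0r.
Qed.

Lemma fourier_series_cst c : fourier_series (normc c) (fun=> c).
Proof.
apply: (@fourier_series_ext _ (fun y => c * y 0)) => [y yD|].
  by rewrite dual0// mulr1.
exact: fourier_series_char.
Qed.

(** Completeness of the algebra, from which sums, products and substitution in power series follow.
    The coefficients of all the [f_ k] form an absolutely summable double family, which [enum_pairs]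
    turns into a single sequence. *)
Lemma fourier_series_sum (f_ : nat -> (G -> R[i]) -> R[i]) (r_ : nat -> R) r f :
  (forall k, fourier_series (r_ k) (f_ k)) ->
  (forall n, \sum_(k < n) r_ k <= r) ->
  (forall y, dual y -> tends (fun n => \sum_(k < n) f_ k y) (f y)) ->
  fourier_series r f.
Proof.
move=> /choice[a] /choice[g] fE rr ff.
have ar N : square_sum (fun i j => normc (a i j)) N <= r.
  by apply: le_trans (rr N); apply: ler_sum => i _; case: (fE i).
(* Where [k] is not the code of a pair, the coefficient is 0 and any point of [S] will do. *)
pose gg k := if pickle_inv k is Some p then g p.1 p.2 else g 0%N 0%N.
exists (enum_pairs a), gg; split.
- have Sg i j : S (g i j) by case: (fE i).
  by move=> n; rewrite /gg; case: pickle_inv.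
- exact: enum_pairs_normc_le.
move=> y yD.
pose u i j := a i j * y (g i j).
apply: (@tends_ext _ (fun n => \sum_(k < n) enum_pairs u k)).
  move=> n; apply: eq_bigr => k _; rewrite /enum_pairs /gg.
  by case: pickle_inv => [//|]; rewrite mul0r.
have ur N : square_sum (fun i j => normc (u i j)) N <= r.
  rewrite (le_trans _ (ar N))//; apply: ler_sum => i _; apply: ler_sum => j _.
  by rewrite normcM dual_normc// mulr1.
have urow i : tends (fun n => \sum_(j < n) u i j) (f_ i y).
  by have [_ _] := fE i; exact.
apply: (tends_enum_pairs ur); apply/(tends_square_rows ur urow).
exact: ff.
Qed.

Lemma fourier_seriesD r r' f h : fourier_series r f -> fourier_series r' h ->
  fourier_series (r + r') (fun y => f y + h y).
Proof.
move=> Af Ah; have := fourier_series_ge0 Af; have := fourier_series_ge0 Ah.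
move=> r'0 r0.
pose f_ k := if k is k'.+1 then if k' is 0 then h else fun=> 0 else f.
pose r_ k : R := if k is k'.+1 then if k' is 0 then r' else 0 else r.
apply: (@fourier_series_sum f_ r_).
- move=> [//|[//|k]]; rewrite /r_ -normc0.
  exact: fourier_series_cst.
- move=> [|[|n]]; first by rewrite big_ord0 addr_ge0.
    by rewrite big_ord_recl big_ord0 addr0 lerDl.
  by rewrite 2!big_ord_recl /= big1// addr0.
move=> y yD; apply: (@tends_near _ (fun=> f y + h y) _ _ 2) (tends_cst _).
by move=> [//|[//|n]] _; rewrite 2!big_ord_recl /= big1// addr0.
Qed.

Lemma fourier_seriesMl_char c x r f : S x -> fourier_series r f ->
  fourier_series (normc c * r) (fun y => c * y x * f y).
Proof.
move=> Sx [a [g [Sg ar af]]]; exists (fun n => c * a n), (fun n => x + g n).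
split=> [n|n|y yD]; first exact: SD.
  have -> : \sum_(i < n) normc (c * a i) = normc c * \sum_(i < n) normc (a i).
    by rewrite mulr_sumr; apply: eq_bigr => i _; rewrite normcM.
  by rewrite ler_wpM2l ?normc_ge0.
apply: tends_ext (tendsMl (c * y x) (af y yD)) => n.
by rewrite mulr_sumr; apply: eq_bigr => i _; rewrite dualD// mulrACA.
Qed.

(** Only the first factor is expanded: its [k]-th term times [h] has norm at most
    [normc (a k) * r']. *)
Lemma fourier_seriesM r r' f h : fourier_series r f -> fourier_series r' h ->
  fourier_series (r * r') (fun y => f y * h y).
Proof.
move=> [a [g [Sg ar af]]] Ah.
apply: (@fourier_series_sum (fun k y => a k * y (g k) * h y)
  (fun k => normc (a k) * r')).
- by move=> k; exact: fourier_seriesMl_char.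
- by move=> n; rewrite -mulr_suml ler_wpM2r// (fourier_series_ge0 Ah).
move=> y yD; rewrite mulrC; apply: tends_ext (tendsMl (h y) (af y yD)) => n.
by rewrite mulr_sumr; apply: eq_bigr => i _; rewrite mulrC.
Qed.

Lemma fourier_seriesMl c r f : fourier_series r f ->
  fourier_series (normc c * r) (fun y => c * f y).
Proof. by move=> Af; apply: fourier_seriesM Af; exact: fourier_series_cst. Qed.

Lemma fourier_seriesB r r' f h : fourier_series r f -> fourier_series r' h ->
  fourier_series (r + r') (fun y => f y - h y).
Proof.
move=> Af /(fourier_seriesMl (-1)) Ah; have := fourier_seriesD Af Ah.
rewrite normcNE normc1 mul1r.
by apply: fourier_series_ext => y _; rewrite mulN1r.
Qed.

Lemma fourier_seriesX r f n : fourier_series r f ->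
  fourier_series (r ^+ n) (fun y => f y ^+ n).
Proof.
move=> Af; elim: n => [|n IH].
  by rewrite expr0 -(@normc1 R); exact: fourier_series_cst.
rewrite exprS; apply: fourier_series_ext (fourier_seriesM Af IH) => y _.
by rewrite exprS.
Qed.

(** On the dual, conjugating [y (g n)] amounts to replacing [g n] by its opposite. *)
Lemma fourier_series_conj r f : fourier_series r f ->
  fourier_series r (fun y => (f y)^*).
Proof.
move=> [a [g [Sg ar af]]]; exists (fun n => (a n)^*), (fun n => - g n).
split=> [n|n|y yD]; first exact: SN.
  by under eq_bigr do rewrite normc_conj.
apply: tends_ext (tends_conj (af y yD)) => n.
by rewrite rmorph_sum; apply: eq_bigr => i _; rewrite rmorphM /= dualN.
Qed.

Lemma normc_half : normc (2^-1 : R[i]) = 2^-1.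
Proof.
have -> : (2^-1 : R[i]) = (2^-1)%:C by rewrite fmorphV rmorph_nat.
by rewrite normc_real ger0_norm// invr_ge0.
Qed.

Lemma fourier_series_Re r f : fourier_series r f ->
  fourier_series r (fun y => (complex.Re (f y))%:C).
Proof.
move=> Af; have := fourier_seriesMl 2^-1 (fourier_seriesD Af
  (fourier_series_conj Af)).
rewrite normc_half -mulr2n -[r *+ 2]mulr_natl mulKf ?pnatr_eq0//.
by apply: fourier_series_ext => y _; rewrite ReJ_add mulrC.
Qed.

Lemma fourier_series_Im r f : fourier_series r f ->
  fourier_series r (fun y => (complex.Im (f y))%:C).
Proof.
move=> Af.
have := fourier_series_Re (fourier_seriesMl (- 'i) Af).
have -> : normc (- 'i : R[i]) = 1.
  by rewrite normcNE /= expr0n expr1n add0r sqrtr1.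
rewrite mul1r; apply: fourier_series_ext => y _.
by case: (f y) => a b /=; congr (_%:C); ring.
Qed.

Lemma fourier_series_pseries (c : nat -> R[i]) r s f h :
  fourier_series r f ->
  (forall n, \sum_(k < n) normc (c k) * r ^+ k <= s) ->
  (forall y, dual y -> tends (fun n => \sum_(k < n) c k * f y ^+ k) (h y)) ->
  fourier_series s h.
Proof.
move=> Af cs ch.
apply: (@fourier_series_sum (fun k y => c k * f y ^+ k)
  (fun k => normc (c k) * r ^+ k)) => // k.
exact/fourier_seriesMl/fourier_seriesX.
Qed.

Lemma fourier_series_double_pseries (c : nat -> nat -> R[i]) r s p q h :
  fourier_series r p -> fourier_series r q ->
  (forall N, square_sum (fun i j =>
    normc (c i j) * (r ^+ i * r ^+ j)) N <= s) ->
  (forall y, dual y ->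
    tends (square_sum (fun i j => c i j * (p y ^+ i * q y ^+ j))) (h y)) ->
  fourier_series s h.
Proof.
move=> Ap Aq cs ch; have r0 := fourier_series_ge0 Ap.
pose u (y : G -> R[i]) i j := c i j * (p y ^+ i * q y ^+ j).
(* [v] holds the bounds on the norms of the terms, embedded in [R[i]] so that [enum_pairs_normc_le]
   applies to them. *)
pose v i j := c i j * (r ^+ i * r ^+ j)%:C.
have normv i j : normc (v i j) = normc (c i j) * (r ^+ i * r ^+ j).
  by rewrite normcM normc_real ger0_norm// mulr_ge0// exprn_ge0.
apply: (@fourier_series_sum (fun k y => enum_pairs (u y) k)
  (fun k => normc (enum_pairs v k))).
- move=> k; rewrite /enum_pairs; case: pickle_inv => [[i j]|].
    rewrite normv /=; apply: fourier_seriesMl.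
    exact: fourier_seriesM (fourier_seriesX _ _) (fourier_seriesX _ _).
  exact: fourier_series_cst.
- apply: enum_pairs_normc_le => N; rewrite (le_trans _ (cs N))//.
  by apply: ler_sum => i _; apply: ler_sum => j _; rewrite normv.
move=> y yD; apply: (@tends_enum_pairs _ (u y) s); last exact: ch.
move=> N; rewrite (le_trans _ (cs N))//.
apply: ler_sum => i _; apply: ler_sum => j _.
rewrite normcM ler_wpM2l ?normc_ge0//.
by rewrite normcM !normcX ler_pM ?exprn_ge0 ?normc_ge0//
  lerXn2r ?nnegrE ?normc_ge0//; exact: fourier_series_normc.
Qed.

End AbsoluteFourierSeries.

(** * The power series of the arcsine *)

Section AsinSeries.
Context {R : realType}.
Implicit Types (x t c : R) (n : nat).

Lemma MVT_bounds (f df : R -> R) (a b m M : R) :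
  (forall x, is_derive x 1 f (df x)) -> a <= b ->
  (forall x, a <= x <= b -> m <= df x <= M) ->
  m * (b - a) <= f b - f a <= M * (b - a).
Proof.
move=> fdf ab dfb.
have [|c + ->] := MVT_segment ab (fun x _ => fdf x).
  by apply: derivable_within_continuous => x _;
    exact: (@ex_derive _ _ _ _ _ _ _ (fdf x)).
rewrite in_itv /= => /dfb/andP[mc cM].
by rewrite !ler_wpM2r// subr_ge0.
Qed.

(** This is the central binomial coefficient of [2n] over [4^n], that is the coefficient of [x^(2n)]
    in the expansion of [1 / sqrt (1 - x^2)]. *)
Definition asin_ratio n : R := \prod_(k < n) ((2 * k%:R + 1) / (2 * k%:R + 2)).
Definition asin_coeff n : R := asin_ratio n / (2 * n%:R + 1).
Definition asin_sum n x := \sum_(k < n) asin_coeff k * x ^+ k.*2.+1.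
Definition asin_sum_deriv n x := \sum_(k < n) asin_ratio k * x ^+ k.*2.

Lemma asin_ratio0 : asin_ratio 0 = 1.
Proof. by rewrite /asin_ratio big_ord0. Qed.

Lemma asin_ratioS n :
  2 * n.+1%:R * asin_ratio n.+1 = (2 * n%:R + 1) * asin_ratio n.
Proof.
rewrite /asin_ratio big_ord_recr /=.
have n0 : 2 * n%:R + 2 != 0 :> R by rewrite gt_eqF// ltr_wpDl// mulr_ge0.
by rewrite -natr1; field.
Qed.

Lemma asin_ratio_ge0 n : 0 <= asin_ratio n.
Proof. by apply: prodr_ge0 => k _; rewrite divr_ge0// addr_ge0// mulr_ge0. Qed.

Lemma asin_ratio_le1 n : asin_ratio n <= 1.
Proof.
elim: n => [|n IH]; first by rewrite asin_ratio0.
rewrite /asin_ratio big_ord_recr /= -/(asin_ratio n).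
apply: mulr_ile1 => //; first exact: asin_ratio_ge0.
by rewrite ler_pdivrMr ?ltr_wpDl ?mulr_ge0// mul1r; lra.
Qed.

Lemma asin_coeff_ge0 n : 0 <= asin_coeff n.
Proof. by rewrite divr_ge0 ?asin_ratio_ge0// addr_ge0// mulr_ge0. Qed.

Lemma natr_doubleS n : n.*2.+1%:R = 2 * n%:R + 1 :> R.
Proof. by rewrite -natr1 -mul2n natrM. Qed.

Lemma is_derive_sinX m t :
  is_derive t 1 (fun t => sin t ^+ m.+1) (m.+1%:R * sin t ^+ m * cos t).
Proof.
rewrite (_ : (fun _ => _) = (@sin R) ^+ m.+1); last first.
  by apply/funext => x; rewrite exprfctE.
by apply: is_derive_eq; rewrite -[_ *: _]/(_ * _).
Qed.

Lemma is_derive_asin_sum_sin n t :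
  is_derive t 1 (fun t => asin_sum n (sin t))
    (asin_sum_deriv n (sin t) * cos t).
Proof.
elim: n => [|n IH].
  rewrite /asin_sum /asin_sum_deriv.
  under eq_fun do rewrite big_ord0.
  by rewrite big_ord0 mul0r; exact: is_derive_cst.
rewrite [X in is_derive _ _ X _](_ : _ = (fun t => asin_sum n (sin t)) \+
   (asin_coeff n \*: (fun t => sin t ^+ n.*2.+1))); last first.
  by apply/funext => x; rewrite /asin_sum big_ord_recr.
apply: is_derive_eq (is_deriveD IH (is_deriveZ _ (is_derive_sinX _ _))) _.
rewrite /asin_sum_deriv big_ord_recr /= mulrDl; congr (_ + _).
rewrite -[LHS]/(_ * _) /asin_coeff natr_doubleS.
have n0 : 2 * n%:R + 1 != 0 :> R by rewrite gt_eqF// ltr_wpDl// mulr_ge0.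
by field.
Qed.

(** With [P] for the polynomial [asin_sum_deriv n.+1], the derivative is [(1 - x^2) P' - x P] at
    [x = sin t]. Since [1 / sqrt (1 - x^2)] solves [(1 - x^2) f' = x f], everything cancels but the
    term due to the truncation. *)
Lemma is_derive_asin_sum_deriv_sin n t :
  is_derive t 1 (fun t => asin_sum_deriv n.+1 (sin t) * cos t)
    (- (2 * n.+1%:R * asin_ratio n.+1) * sin t ^+ n.*2.+1).
Proof.
elim: n => [|n IH].
  rewrite [X in is_derive _ _ X _](_ : _ = @cos R); last first.
    apply/funext => x; rewrite /asin_sum_deriv big_ord_recl big_ord0 /=.
    by rewrite asin_ratio0 expr0 !mulr1 addr0 mul1r.
  apply: is_derive_eq; rewrite asin_ratioS asin_ratio0 expr1; ring.
rewrite [X in is_derive _ _ X _](_ : _ =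
   (fun t => asin_sum_deriv n.+1 (sin t) * cos t) \+
   (asin_ratio n.+1 \*: ((fun t => sin t ^+ n.*2.+2) * cos))); last first.
  apply/funext => x; rewrite /asin_sum_deriv big_ord_recr /= mulrDl.
  by congr (_ + _); rewrite -mulrA.
apply: is_derive_eq (is_deriveD IH (is_deriveZ _ (is_deriveM (is_derive_sinX _
  _) (is_derive_cos _)))) _.
rewrite [in RHS]asin_ratioS -[_ *: (_ + _)]/(_ * (_ + _)) -[_ *: - _]/(_ * - _).
rewrite -[cos t *: _]/(_ * _).
have -> : cos t * (n.*2.+2%:R * sin t ^+ n.*2.+1 * cos t) =
    n.*2.+2%:R * sin t ^+ n.*2.+1 * (1 - sin t ^+ 2).
  by rewrite -cos2sin2; ring.
have -> : n.*2.+2%:R = 2 * n.+1%:R :> R by rewrite -doubleS -mul2n natrM.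
rewrite ?doubleS !exprS. ring.
Qed.

Lemma asin_sum_deriv_ge0 n t : - (pi / 2) <= t <= pi / 2 ->
  0 <= asin_sum_deriv n (sin t) * cos t.
Proof.
move=> tpi; rewrite mulr_ge0// ?cos_ge0_pihalf//.
by apply: sumr_ge0 => k _;
  rewrite mulr_ge0 ?asin_ratio_ge0// -mul2n exprM exprn_ge0// sqr_ge0.
Qed.

Lemma asin_sum_deriv0 n : asin_sum_deriv n.+1 (sin 0) * cos 0 = 1.
Proof.
rewrite sin0 cos0 mulr1 /asin_sum_deriv big_ord_recl /= expr0 asin_ratio0.
by rewrite big1 ?addr0 ?mulr1// => i _; rewrite doubleS exprS mul0r mulr0.
Qed.

(** The function is 1 at 0, and its derivative is nonpositive on the interval. *)
Lemma asin_sum_deriv_le1 n t : 0 <= t <= pi / 2 ->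
  asin_sum_deriv n.+1 (sin t) * cos t <= 1.
Proof.
move=> /andP[t0 tpi].
have pi0 := pi_gt0 R.
have s0 x : 0 <= x <= t -> 0 <= sin x.
  by move=> /andP[x0 xt]; apply: sin_ge0_pi; rewrite x0/=; lra.
have := @MVT_bounds _ _ 0 t (- (2 * n.+1%:R * asin_ratio n.+1)) 0
  (is_derive_asin_sum_deriv_sin n) t0.
rewrite asin_sum_deriv0 mul0r => /(_ _)/andP[|_]; last by rewrite subr_le0.
move=> x /s0 sx; have A : 0 <= 2 * n.+1%:R * asin_ratio n.+1.
  by rewrite !mulr_ge0// asin_ratio_ge0.
have [sp1 sp0] : sin x ^+ n.*2.+1 <= 1 /\ 0 <= sin x ^+ n.*2.+1.
  by rewrite exprn_ge0// exprn_ile1 ?sin_le1.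
by apply/andP; split; nra.
Qed.

(** As [asin_ratio n.+1 <= 1], the derivative is at least [- 2 (n+1) (sin c)^(2n+1)] on [[0, c]]; so
    the function, which is 1 at 0, drops by at most [c] times this rate. *)
Lemma asin_sum_deriv_ge n c t : 0 <= t <= c -> c <= pi / 2 ->
  1 - c * (2 * n.+1%:R * sin c ^+ n.*2.+1)
    <= asin_sum_deriv n.+1 (sin t) * cos t.
Proof.
move=> /andP[t0 tc] cpi.
have pi0 := pi_gt0 R.
have c0 := le_trans t0 tc.
have scx x : 0 <= x <= c -> 0 <= sin x <= sin c.
  move=> /andP[x0 xc]; apply/andP; split.
    by apply: sin_ge0_pi; rewrite x0/=; lra.
  rewrite leNgt ltr_sin ?in_itv/= -?leNgt//; apply/andP; split; lra.
have /andP[sc0 _] : 0 <= sin c <= sin c by apply: scx; rewrite c0/=.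
pose K := 2 * n.+1%:R * sin c ^+ n.*2.+1.
have K0 : 0 <= K by rewrite !mulr_ge0// exprn_ge0.
have := @MVT_bounds _ _ 0 t (- K) 0 (is_derive_asin_sum_deriv_sin n) t0.
rewrite asin_sum_deriv0 => /(_ _)/andP[|].
  move=> x /andP[x0 xt];
    have /andP[sx0 sxc] : 0 <= sin x <= sin c by apply: scx;
    rewrite x0 (le_trans xt).
  have sp0 : 0 <= sin x ^+ n.*2.+1 by rewrite exprn_ge0.
  have spc : sin x ^+ n.*2.+1 <= sin c ^+ n.*2.+1 by rewrite lerXn2r.
  have A : 0 <= 2 * n.+1%:R * asin_ratio n.+1 <= 2 * n.+1%:R.
    by rewrite !mulr_ge0 ?asin_ratio_ge0//= ler_piMr ?asin_ratio_le1// mulr_ge0.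
  apply/andP; split; last by nra.
  rewrite mulNr lerN2 /K; apply: ler_pM => //; by case/andP: A.
rewrite -/K => H _; nra.
Qed.

Lemma asin_sum0 n : asin_sum n 0 = 0.
Proof. by apply: big1 => i _; rewrite exprS mul0r mulr0. Qed.

Lemma asin_sum_sin_le n t : 0 <= t <= pi / 2 ->
  0 <= asin_sum n.+1 (sin t) <= t.
Proof.
move=> /andP[t0 tpi]; have pi0 := pi_gt0 R.
have := @MVT_bounds _ _ 0 t 0 1 (is_derive_asin_sum_sin n.+1) t0.
rewrite sin0 asin_sum0 !subr0 mul0r mul1r; apply=> x /andP[x0 xt].
rewrite asin_sum_deriv_ge0 ?asin_sum_deriv_le1//; first by apply/andP; split;
  lra.
by apply/andP; split; lra.
Qed.

(** The slope is at least [1 - K] up to [c] and nonnegative from [c] to [t]. A choice of [c < t]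
    makes [sin c < 1], hence the error small for large [n], even at [t = pi / 2]. *)
Lemma asin_sum_sin_ge n c t : 0 <= c <= t -> t <= pi / 2 ->
  c - c * (c * (2 * n.+1%:R * sin c ^+ n.*2.+1)) <= asin_sum n.+1 (sin t).
Proof.
move=> /andP[c0 ct] tpi; have pi0 := pi_gt0 R.
set K := c * (2 * n.+1%:R * sin c ^+ n.*2.+1).
have K0 : 0 <= K.
  rewrite mulr_ge0// mulr_ge0 ?mulr_ge0// exprn_ge0// sin_ge0_pi// c0/=; lra.
have := @MVT_bounds _ _ 0 c (1 - K) 1 (is_derive_asin_sum_sin n.+1) c0.
rewrite sin0 asin_sum0.
move=> /(_ _)/andP[x /andP[x0 xt]|H _].
  rewrite asin_sum_deriv_ge ?x0 ?asin_sum_deriv_le1 ?x0//=; lra.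
have := @MVT_bounds _ _ c t 0 1 (is_derive_asin_sum_sin n.+1) ct.
move=> /(_ _)/andP[x /andP[x0 xt]|H' _].
  rewrite asin_sum_deriv_ge0 ?asin_sum_deriv_le1//; apply/andP; split; lra.
move: H H'; rewrite !subr0 mul0r; lra.
Qed.

(** Each of the [n] terms of the geometric sum [1 + s + ... + s^(n-1)] is at least [s^n]. *)
Lemma natr_mul_expr_le (s : R) n : 0 <= s < 1 -> n%:R * s ^+ n * (1 - s) <= 1.
Proof.
move=> /andP[s0 s1].
have sn0 : 0 <= s ^+ n by rewrite exprn_ge0.
have : n%:R * s ^+ n <= \sum_(i < n) s ^+ i.
  rewrite mulr_natl -[X in _ *+ X]card_ord -sumr_const.
  by apply: ler_sum => i _; rewrite ler_wiXn2l ?(ltW s1)// ltnW.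
have := subrX1 s n; set T := \sum_(i < n) _ => E H.
have : (1 - s) * T = 1 - s ^+ n by rewrite -[1 - s]opprB mulNr -E opprB.
nra.
Qed.

(** The factor [(n+1) s^(n+1)] stays bounded, and the remaining factor [s^n] tends to 0. *)
Lemma natr_mul_expr_small (s e : R) : 0 <= s < 1 -> 0 < e ->
  exists N, forall n, (N <= n)%N -> n.+1%:R * s ^+ n.*2.+1 <= e.
Proof.
move=> /andP[s0 s1] e0.
have d0 : 0 < (1 - s) * e by rewrite mulr_gt0// subr_gt0.
have /cvgrPdist_le/(_ _ d0)[N _ Nn] : (fun n => s ^+ n) @ \oo --> (0 : R).
  by apply: cvg_expr; rewrite ger0_norm.
exists N => n /Nn /=; rewrite sub0r normrN ger0_norm ?exprn_ge0// => sn.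
have sn0 : 0 <= n.+1%:R * s ^+ n.+1 by rewrite mulr_ge0// exprn_ge0.
have := @natr_mul_expr_le s n.+1; rewrite s0 s1 => /(_ isT) H.
have -> : n.+1%:R * s ^+ n.*2.+1 = n.+1%:R * s ^+ n.+1 * s ^+ n.
  by rewrite -mulrA -exprD; congr (_ * _ ^+ _); rewrite -addnn addSn.
have := ler_wpM2l sn0 sn; rewrite mulrA; nra.
Qed.

Lemma asin_sum_sin_cvg_ge0 t : 0 <= t <= pi / 2 ->
  asin_sum ^~ (sin t) @ \oo --> t.
Proof.
move=> /[dup] tI /andP[t0 tpi]; have pi0 := pi_gt0 R.
apply/cvgrPdist_le => e e0.
have [te|et] := leP t e.
  exists 1%N => // -[//|n] _ /=; have /andP[] := asin_sum_sin_le n tI.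
  by move=> *; rewrite ger0_norm; lra.
(* One half of the tolerance is spent on [t - c], the other on the error term of [asin_sum_sin_ge],
   which determines [N]. *)
pose c := t - e / 2.
have cI : 0 < c < pi / 2 by rewrite /c; apply/andP; split; lra.
have /andP[c0 cpi] := cI.
have sI : 0 <= sin c < 1.
  rewrite sin_ge0_pi/=; last by apply/andP; split; lra.
  rewrite -sin_pihalf ltr_sin// in_itv/=; apply/andP; split; lra.
have cc0 : 0 < c * c by rewrite mulr_gt0.
have [N Nn] := natr_mul_expr_small sI (divr_gt0 (divr_gt0 e0 (ltr0Sn _ 1))
  (mulr_gt0 (ltr0Sn R 1) cc0)).
exists N.+1 => // -[//|n] /= /Nn; rewrite ler_pdivlMr ?mulr_gt0// => H.
have /andP[_ ub] := asin_sum_sin_le n tI.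
have := @asin_sum_sin_ge n c t _ tpi.
rewrite (ltW c0) /= => /(_ _) lb.
rewrite ger0_norm ?subr_ge0//.
have {}lb : c - c * (c * (2 * n.+1%:R * sin c ^+ n.*2.+1)) <= asin_sum n.+1 (sin
  t).
  by apply: lb; rewrite /c; lra.
have E : c * (c * (2 * n.+1%:R * sin c ^+ n.*2.+1)) =
  n.+1%:R * sin c ^+ n.*2.+1 * (2 * (c * c)) by ring.
have cE : c = t - e / 2 by [].
rewrite {}E in lb; move: H lb; set X := _ * (2 * (c * c)); lra.
Qed.

Lemma asin_sumN n x : asin_sum n (- x) = - asin_sum n x.
Proof.
rewrite /asin_sum -sumrN; apply: eq_bigr => i _.
by rewrite exprNn -signr_odd /= odd_double /= expr1 mulN1r mulrN.
Qed.

Lemma asin_sum_cvg x : -1 <= x <= 1 -> asin_sum ^~ x @ \oo --> asin x.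
Proof.
move=> x1.
have xE : x = sin (asin x) by rewrite asinK// in_itv.
have xpi : asin x <= pi / 2 by exact: asin_lepi2.
have xNpi : - (pi / 2) <= asin x by exact: asin_geNpi2.
have [x0|x0] := leP 0 (asin x).
  by rewrite [X in asin_sum ^~ X]xE; apply: asin_sum_sin_cvg_ge0; rewrite x0.
have Nx : 0 <= - asin x <= pi / 2 by apply/andP; split; lra.
have := cvgN (asin_sum_sin_cvg_ge0 Nx); rewrite opprK sinN.
have -> : - (asin_sum ^~ (- sin (asin x))) = asin_sum ^~ (sin (asin x)).
  by apply/funext => n; rewrite fctE /= asin_sumN opprK.
by rewrite -xE; apply.
Qed.

(** The left-hand side is the partial sum at [1 = sin (pi / 2)]. The coefficients being nonnegative,
    this is absolute convergence at 1. *)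
Lemma sum_asin_coeff_le n : \sum_(k < n) asin_coeff k <= pi / 2.
Proof.
have pi0 := pi_gt0 R.
case: n => [|n]; first by rewrite big_ord0; lra.
have /andP[_] := @asin_sum_sin_le n (pi / 2) ltac:(apply/andP; split; lra).
by rewrite sin_pihalf /asin_sum; under eq_bigr do rewrite expr1n mulr1.
Qed.

End AsinSeries.

(** * Short arcs of the unit circle *)

Section UnitCircle.
Context {R : realType}.
Implicit Types (s t a b : R) (z : R[i]).

Definition cis t : R[i] := cos t +i* sin t.

Lemma cisD s t : cis (s + t) = cis s * cis t.
Proof.
by apply/eqP; rewrite eq_complex /= cosD sinD [_ + cos s * _]addrC !eqxx.
Qed.

Lemma cis0 : cis 0 = 1. Proof. by rewrite /cis cos0 sin0. Qed.

Lemma cisMn t n : cis (n%:R * t) = cis t ^+ n.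
Proof.
elim: n => [|n IH]; first by rewrite mul0r cis0.
by rewrite -natr1 mulrDl mul1r addrC cisD IH exprS.
Qed.

Lemma normc_cis t : normc (cis t) = 1.
Proof. by rewrite /= cos2Dsin2 sqrtr1. Qed.

Lemma cis_surj z : normc z = 1 -> exists2 t, - pi <= t <= pi & z = cis t.
Proof.
case: z => a b /= ab1.
have ab : a ^+ 2 + b ^+ 2 = 1.
  by rewrite -[LHS]sqr_sqrtr ?addr_ge0 ?sqr_ge0// ab1 expr1n.
have a1 : -1 <= a <= 1 by apply/andP; split; nra.
have bE : Num.sqrt (1 - a ^+ 2) = `|b| by rewrite -ab addrC addKr sqrtr_sqr.
have [acos0 acospi] := (acos_ge0 a1, acos_lepi a1).
have cosE : cos (acos a) = a by rewrite acosK// in_itv.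
have [b0|b0] := leP 0 b.
  exists (acos a); first by apply/andP; split; lra.
  by rewrite /cis cosE sin_acos// bE ger0_norm.
exists (- acos a); first by apply/andP; split; lra.
by rewrite /cis cosN sinN cosE sin_acos// bE ltr0_norm// opprK.
Qed.

Lemma asin_cos t : - pi <= t <= pi -> asin (cos t) = pi / 2 - `|t|.
Proof.
move=> /andP[tNpi tpi].
have tpi' : `|t| <= pi by rewrite ler_norml tNpi.
rewrite -cos_norm -[`|t| in LHS](subKr (pi / 2)).
rewrite -[_ - (_ - _)]opprB cosN cosBpihalf sinK// in_itv/=.
have := normr_ge0 t; set u := `|t| in tpi' *; lra.
Qed.

(** The reflection [2 * pi - t] leads back to [asin_cos]. This branch occurs when a translation
    pushes the argument of the triangle wave beyond [pi]. *)
Lemma asin_cos_pi2pi t : pi <= t <= 2 * pi -> asin (cos t) = t - 3 * pi / 2.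
Proof.
move=> /andP[pit tpi]; have pi0 := pi_gt0 R.
have -> : cos t = cos (2 * pi - t).
  by rewrite -cosN -(cosD2pi (- t)) mulr2n; congr (cos _); ring.
rewrite asin_cos; last by apply/andP; split; lra.
by rewrite ger0_norm; lra.
Qed.

(* As [asin (cos t)] is a triangle wave, the first factor is a trapezoid at [0]
   minus its translate by [pi]; the second factor is [1] near [0] and vanishes
   near [pi]. *)
Definition window b t : R :=
  let tri u := asin (cos u) in
  (tri (t + b / 2) + tri (t - b / 2) - tri (t + b) - tri (t - b)) / b *
  ((1 + (tri (t + pi / 4) + tri (t - pi / 4)) / (pi / 2)) / 2).

Lemma windowN b t : window b (- t) = window b t.
Proof.
have cosND u v : cos (- u + v) = cos (u - v) by rewrite -cosN opprD opprK.
rewrite /window -!opprD !cosN !cosND.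
by congr (_ / b * ((1 + _ / _) / 2)); ring.
Qed.

Lemma window_norm b t : window b t = window b `|t|.
Proof. by have [//|_] := ger0P t; rewrite windowN. Qed.

Lemma window1 b t : 0 < b <= pi / 4 -> `|t| <= b / 2 -> window b t = 1.
Proof.
move=> /andP[b0 bpi] tb; have pi0 := pi_gt0 R.
rewrite window_norm; have := normr_ge0 t; set u := `|t| in tb * => u0.
rewrite /window !asin_cos; do ?by apply/andP; split; lra.
rewrite (ger0_norm (_ : 0 <= u + b / 2)); last by lra.
rewrite (ler0_norm (_ : u - b / 2 <= 0)); last by lra.
rewrite (ger0_norm (_ : 0 <= u + b)); last by lra.
rewrite (ler0_norm (_ : u - b <= 0)); last by lra.
rewrite (ger0_norm (_ : 0 <= u + pi / 4)); last by lra.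
rewrite (ler0_norm (_ : u - pi / 4 <= 0)); last by lra.
by clear -b0 pi0; move: (pi) pi0 => p p0; field; rewrite !gt_eqF.
Qed.

Lemma window0 b t : 0 < b <= pi / 4 -> b <= `|t| <= pi -> window b t = 0.
Proof.
move=> /andP[b0 bpi]; rewrite window_norm.
have := normr_ge0 t; set u := `|t| => u0 /andP[bu upi]; have pi0 := pi_gt0 R.
(* If [u + b <= pi], the four waves of the first factor are on a common affine branch and cancel.
   Otherwise [u] exceeds [3 * pi / 4] and the second factor vanishes. *)
have [ub|bu'] := leP (u + b) pi.
  rewrite /window !(@asin_cos (u + b / 2), @asin_cos (u - b / 2),
    @asin_cos (u + b), @asin_cos (u - b)); do ?by apply/andP; split; lra.
  rewrite !ger0_norm; [|lra..].
  by rewrite [X in X / b](_ : _ = 0) ?mul0r//; ring.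
rewrite /window (@asin_cos_pi2pi (u + pi / 4)); last by apply/andP; split; lra.
rewrite (@asin_cos (u - pi / 4)); last by apply/andP; split; lra.
rewrite (ger0_norm (_ : 0 <= u - pi / 4)); last by lra.
rewrite [X in _ * (X / 2)](_ : _ = 0) ?mul0r ?mulr0//.
by clear -pi0; move: (pi) pi0 => p p0; field; rewrite gt_eqF.
Qed.

(** The exponential series: the coefficient is [i^k / k!], written by its real and imaginary
    parts. *)
Lemma cis_series t :
  tends (fun n => \sum_(k < n) (cos_coeff 1 k +i* sin_coeff 1 k) * (t ^+ k)%:C)
    (cis t).
Proof.
have tc : tends (fun n => (series (cos_coeff t) n)%:C) (cos t)%:C.
  by apply: tends_real; rewrite unlock; exact: is_cvg_series_cos_coeff.
have ts : tends (fun n => (series (sin_coeff t) n)%:C) (sin t)%:C.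
  by apply: tends_real; rewrite unlock; exact: is_cvg_series_sin_coeff.
have -> : cis t = (cos t)%:C + 'i * (sin t)%:C by rewrite [LHS]complexE.
apply: tends_ext (tendsD tc (tendsMl 'i ts)) => n.
rewrite /series /= !big_mkord !rmorph_sum mulr_sumr -big_split /=.
apply: eq_bigr => k _; apply/eqP;
  rewrite eq_complex /= /cos_coeff /sin_coeff /=.
by rewrite !expr1n; apply/andP; split; apply/eqP; ring.
Qed.

Lemma normc_cis_coeff k :
  normc (cos_coeff 1 k +i* sin_coeff 1 k : R[i]) <= 1.
Proof.
apply: le_trans (normc_le_ReIm _) _ => /=.
rewrite /cos_coeff /sin_coeff /= expr1n !mulr1 !normrM normfV normr_nat.
rewrite !normrX !normrN1 !expr1n !mulr1.
rewrite normr_nat normr_nat -mulrDl ler_pdivrMr ?ltr0n ?fact_gt0// mul1r.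
by case: (odd k); rewrite ?add0r ?addr0 ler1n fact_gt0.
Qed.

End UnitCircle.

(** * Windows and local elements of small norm in the algebra *)

Section Localization.
Context {R : realType} {G : topologicalZmodType} (S : set G).
Hypotheses (S0 : S 0) (SD : forall x x', S x -> S x' -> S (x + x'))
  (SN : forall x, S x -> S (- x)).
Implicit Types (f h : (G -> R[i]) -> R[i]) (y : G -> R[i])
  (r b s t : R) (c : R[i]).

(** Norm 1 is the edge of the disc of convergence; the substitution is possible because the
    coefficients are nonnegative with sum at most [pi / 2]. *)
Lemma fourier_series_asin (f : (G -> R[i]) -> R) :
  fourier_series S 1 (fun y => (f y)%:C) ->
  fourier_series S (pi / 2) (fun y => (asin (f y))%:C).
Proof.
move=> Af.
have f1 y : dual y -> -1 <= f y <= 1.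
  move=> yD; rewrite -ler_norml -normc_real.
  exact: fourier_series_normc Af yD.
apply: (@fourier_series_sum _ _ _ (fun k y =>
  (asin_coeff k)%:C * (f y)%:C ^+ k.*2.+1)
   asin_coeff).
- move=> k.
  have := fourier_seriesMl S0 SD (asin_coeff k)%:C (fourier_seriesX S0 SD
    k.*2.+1 Af).
  by rewrite expr1n mulr1 normc_real ger0_norm ?asin_coeff_ge0.
- exact: sum_asin_coeff_le.
move=> y yD; have := tends_real (asin_sum_cvg (f1 y yD)).
apply: tends_ext => n; rewrite rmorph_sum; apply: eq_bigr => k _.
by rewrite rmorphM rmorphXn.
Qed.

Lemma fourier_series_asin_Re s x : S x ->
  fourier_series S (pi / 2)
    (fun y : G -> R[i] => (asin (complex.Re (cis s * y x)))%:C).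
Proof.
move=> Sx; apply/fourier_series_asin/(fourier_series_Re S0 SD SN).
by rewrite -(normc_cis s); exact: fourier_series_char.
Qed.

(** The exponential series without its constant term has norm at most [r + r^2 + ...], and
    [r <= 1/2]. *)
Lemma fourier_series_cis_sub1 r (t : (G -> R[i]) -> R) : r <= 2^-1 ->
  fourier_series S r (fun y => (t y)%:C) ->
  fourier_series S (2 * r) (fun y => cis (t y) - 1).
Proof.
move=> r2 At; have r0 := fourier_series_ge0 At.
pose c k : R[i] := if k is 0 then 0 else cos_coeff 1 k +i* sin_coeff 1 k.
apply: (fourier_series_pseries S0 SD (c := c) At).
  move=> [|n]; first by rewrite big_ord0 mulr_ge0.
  (* This sharper bound is the one that goes through the induction. *)
  apply: (@le_trans _ _ (2 * r - 2 * r ^+ n.+1)); last first.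
    by rewrite gerBl mulr_ge0// exprn_ge0.
  elim: n => [|n IH].
    rewrite big_ord_recr big_ord0 (_ : c _ = 0)// normc0.
    by rewrite mul0r /= addr0 expr1 subrr.
  rewrite big_ord_recr /= (le_trans (lerD IH (ler_wpM2r _ (normc_cis_coeff
    n.+1))))//.
    by rewrite exprn_ge0.
  have : 0 <= r ^+ n.+1 by rewrite exprn_ge0.
  by rewrite [r ^+ n.+2]exprS; nra.
move=> y yD.
apply: (tends_near (N :=
  1)) (tendsB (cis_series (t y)) (tends_cst 1)) => -[//|n] _.
rewrite !big_ord_recl /= /c mul0r add0r.
rewrite [X in X + _ - _](_ : _ = 1); last first.
  apply/eqP; rewrite eq_complex /= /cos_coeff /sin_coeff /=.
  by rewrite !expr0 fact0 !mulr1 !mul0r !mulr0 subr0 addr0 divr1 !eqxx.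
rewrite addrC addKr; apply: eq_bigr => k _.
by rewrite rmorphXn.
Qed.

(** When [cis s * y x = cis t], the wave [asin (cos (t + u))] is the arcsine of the real part of
    [cis (u + s) * y x], so the window is obtained from [y x] without any choice of an argument
    [t]. *)
Lemma fourier_series_window b s x : S x -> exists r (w : (G -> R[i]) -> R),
  fourier_series S r (fun y => (w y)%:C) /\
  forall y t, cis s * y x = cis t -> w y = window b t.
Proof.
move=> Sx.
pose tri u (y : G -> R[i]) : R := asin (complex.Re (cis (u + s) * y x)).
have Atri u : fourier_series S (pi / 2) (fun y => (tri u y)%:C).
  exact: fourier_series_asin_Re.
pose w y := (tri (b / 2) y + tri (- (b / 2)) y - tri b y - tri (- b) y) / b *
  ((1 + (tri (pi / 4) y + tri (- (pi / 4)) y) / (pi / 2)) / 2).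
have AE := fourier_seriesB S0 SD (fourier_seriesB S0 SD
  (fourier_seriesD S0 (Atri (b / 2)) (Atri (- (b / 2)))) (Atri b)) (Atri (- b)).
have AW := fourier_seriesD S0 (fourier_series_cst S0 1)
  (fourier_seriesMl S0 SD ((pi / 2)^-1)%:C
    (fourier_seriesD S0 (Atri (pi / 4)) (Atri (- (pi / 4))))).
have Aw := fourier_seriesM SD (fourier_seriesMl S0 SD (b^-1)%:C AE)
  (fourier_seriesMl S0 SD (2^-1)%:C AW).
eexists; exists w; split.
  apply: fourier_series_ext Aw => y _.
  apply/eqP; rewrite eq_complex /= /w; apply/andP; split; apply/eqP; ring.
move=> y t yt; rewrite /w /tri /window.
suff E u : complex.Re (cis (u + s) * y x) = cos (t + u) by rewrite !E.
by rewrite cisD -mulrA yt -cisD addrC.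
Qed.

(* [t = asin (sin (m t)) / m] has norm at most [pi / (2 m)], hence
   [cis t - 1] has norm at most twice as much. *)
Lemma fourier_series_chart m s x : S x -> (4 <= m)%N ->
  exists u, fourier_series S (pi / m%:R) u /\
  forall y t, dual y -> cis s * y x = cis t -> `|t| <= pi / (2 * m%:R) ->
    u y = y x - cis (- s).
Proof.
move=> Sx m4; have pi0 := pi_gt0 R.
have m4' : 4 <= m%:R :> R by rewrite ler_nat.
have m0 : 0 < m%:R :> R by rewrite (lt_le_trans _ m4').
have Smx : S (x *+ m).
  by elim: m {m4 m4' m0} => [|m IH]; rewrite ?mulr0n// mulrS; exact: SD.
(* If [cis s * y x = cis t], the real part is [cos (m t - pi / 2) = sin (m t)]. *)
pose tau (y : G -> R[i]) : R :=
  asin (complex.Re (cis (m%:R * s - pi / 2) * y (x *+ m))) / m%:R.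
have Atau : fourier_series S (pi / (2 * m%:R)) (fun y => (tau y)%:C).
  have := fourier_seriesMl S0 SD (m%:R^-1)%:C
    (fourier_series_asin_Re (m%:R * s - pi / 2) Smx).
  rewrite normc_real ger0_norm ?invr_ge0 ?(ltW m0)//.
  have -> : m%:R^-1 * (pi / 2) = pi / (2 * m%:R) :> R.
    by move: (pi : R) => p; field; rewrite gt_eqF.
  by apply: fourier_series_ext => y _; rewrite -rmorphM /tau mulrC.
(* Together with [4 <= m], this yields the bound [pi / (2 m) <= 1/2] that [fourier_series_cis_sub1]
   requires. *)
have pi4 : pi <= 4 :> R by have := @pihalf_lt2 R; lra.
have Au := fourier_seriesMl S0 SD (cis (- s)) (fourier_series_cis_sub1 _ Atau).
exists (fun y => cis (- s) * (cis (tau y) - 1)); split.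
  have := Au _; rewrite normc_cis mul1r.
  have -> : 2 * (pi / (2 * m%:R)) = pi / m%:R :> R.
    by move: (pi : R) => p; field; rewrite gt_eqF.
  apply; rewrite ler_pdivrMr ?mulr_gt0//; lra.
move=> y t yD yt tm; have -> : tau y = t.
  have yxE : y x = cis (t - s).
    apply: (mulfI (_ : cis s != 0)).
      apply/eqP => s0; have := normc_cis s.
      by rewrite s0 normc0 => /esym/eqP; rewrite oner_eq0.
    by rewrite yt -cisD addrC subrK.
  rewrite /tau dualMn// yxE -cisMn -cisD.
  rewrite (_ : m%:R * s - pi / 2 + _ = m%:R * t - pi / 2); last by ring.
  rewrite /cis /= cosBpihalf sinK; first by rewrite mulrC mulKf// gt_eqF.
  rewrite in_itv /= -ler_norml normrM ger0_norm; last exact: ltW.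
  by move: tm; rewrite invfM mulrA ler_pdivlMr// mulrC.
by rewrite mulrBr mulr1 -yt mulrA -cisD addNr cis0 mul1r.
Qed.

(* The centres [z i] are the points [cis (i * pi / (4 m) - pi)], half the
   radius of a window apart. *)
Lemma fourier_series_cover x (e : R) : S x -> 0 < e ->
  exists (n : nat) (w u : nat -> (G -> R[i]) -> R[i]) (z : nat -> R[i]),
  [/\ forall i, exists r, fourier_series S r (w i),
      forall i, fourier_series S e (u i),
      forall i y, dual y -> w i y != 0 -> u i y = y x - z i
    & forall y, dual y -> exists2 i, (i < n)%N & w i y = 1].
Proof.
move=> Sx e0; have pi0 := pi_gt0 R.
have pe : 0 <= pi / e by rewrite divr_ge0// ltW.
(* The Archimedean bound ensures [pi / m <= e], and the shift ensures [4 <= m]. *)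
pose m := (Num.bound (pi / e)).+4.
have m4 : (4 <= m)%N by [].
have m0 : 0 < m%:R :> R by rewrite ltr0n.
have me : pi / m%:R <= e.
  rewrite ler_pdivrMr// mulrC -ler_pdivrMr//.
  rewrite (le_trans (ltW (archi_boundP pe)))// ler_nat.
  by rewrite /m -addn4 leq_addr.
(* Both the radius beyond which the windows vanish and the range on which [fourier_series_chart] is
   exact. *)
pose b : R := pi / (2 * m%:R).
have b0 : 0 < b by rewrite divr_gt0// mulr_gt0.
have bpi : 0 < b <= pi / 4.
  rewrite b0 ler_pM2l// lef_pV2 ?posrE ?mulr_gt0//.
  have m4' : 4 <= m%:R :> R by rewrite ler_nat.
  lra.
pose s (i : nat) : R := pi - i%:R * (b / 2).
have /choice[r /choice[w wE]] := fun i => @fourier_series_window b (s i) x Sx.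
have /choice[u uE] := fun i => fourier_series_chart (s i) Sx m4.
exists (8 * m)%N.+1, (fun i y => (w i y)%:C), u, (fun i => cis (- s i)); split.
- by move=> i; exists (r i); case: (wE i).
- by move=> i; exact: fourier_series_le me (uE i).1.
- move=> i y yD wy.
  have [t tpi yt] : exists2 t, - pi <= t <= pi & cis (s i) * y x = cis t.
    apply: cis_surj.
    by rewrite normcM normc_cis dual_normc// mulr1.
  apply: ((uE _).2 _ t) => //; rewrite leNgt; apply/negP => bt.
  case: (wE i) => _ /(_ _ _ yt) wt; move: wy; rewrite wt window0 ?eqxx//.
  by rewrite (ltW bt)/= ler_norml.
move=> y yD.
have [t /andP[tpi1 tpi2] yt] := cis_surj (dual_normc x yD).
have b2 : 0 < b / 2 by rewrite divr_gt0.
have tb : 0 <= (t + pi) / (b / 2) by rewrite divr_ge0//; lra.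
(* Then [0 <= t + s i < b / 2], where the window is 1; and [i <= 8 m] because
   [t + pi <= 2 * pi = 8 m (b / 2)]. *)
pose i := Num.truncn ((t + pi) / (b / 2)).
have /andP[i1 i2] : i%:R <= (t + pi) / (b / 2) < i.+1%:R by exact: truncn_itv.
rewrite ler_pdivlMr// in i1.
rewrite ltr_pdivrMr// -natr1 in i2.
exists i.
  rewrite ltnS -(ler_nat R); apply: le_trans (_ : (t + pi) / (b / 2) <= _).
    by rewrite ler_pdivlMr.
  rewrite ler_pdivrMr// natrM /b.
  have -> : 8 * m%:R * (pi / (2 * m%:R) / 2) = 2 * pi :> R.
    by move: (pi : R) => p; field; rewrite gt_eqF.
  lra.
have [_ /(_ y (t + s i)) ->] := wE i; last by rewrite yt -cisD addrC.
rewrite window1// ler_norml /s; apply/andP; split; nra.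
Qed.

End Localization.

(** * Gluing, and composition with a real-analytic function *)

Section Gluing.
Context {R : realType} {G : topologicalZmodType} (S : set G).
Hypotheses (S0 : S 0) (SD : forall x x', S x -> S x' -> S (x + x'))
  (SN : forall x, S x -> S (- x)).
Implicit Types (f h : (G -> R[i]) -> R[i]) (X Y : set (G -> R[i])).

Definition fourier_series_on X f := exists r F,
  fourier_series S r F /\ forall y, X y -> F y = f y.

(** The glued element is the sum over [i] of [w i * F i] times the product of the [1 - w j] for
    [j < i]. On [X] it is [f * (1 - P)], where the product [P] of all the [1 - w i] vanishes. Where
    [w i] is 0, the value of [F i] is irrelevant. *)
Lemma fourier_series_on_glue X f n (w : nat -> (G -> R[i]) -> R[i]) :
  (forall i, exists r, fourier_series S r (w i)) ->
  (forall y, X y -> exists2 i, (i < n)%N & w i y = 1) ->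
  (forall i, fourier_series_on (X `&` [set y | w i y != 0]) f) ->
  fourier_series_on X f.
Proof.
move=> /choice[r Aw] w1 /choice[s /choice[F FE]].
suff [s' [F' [r' [P [AF AP] E]]]] : exists s' F' r' P,
    [/\ fourier_series S s' F', fourier_series S r' P
      & forall y, X y -> P y = \prod_(i < n) (1 - w i y) /\
          F' y = f y * (1 - P y)].
  exists s', F'; split=> // y Xy; have [PE ->] := E y Xy.
  have [i ilt wi1] := w1 y Xy.
  rewrite (_ : P y = 0) ?subr0 ?mulr1// PE.
  by rewrite (bigD1 (Ordinal ilt))//= wi1 subrr mul0r.
elim: n {w1} => [|n [s' [F' [r' [P [AF AP] E]]]]].
  exists (normc (0 : R[i])), (fun=> 0), (normc (1 : R[i])), (fun=> 1).
  split; [exact: fourier_series_cst|exact: fourier_series_cst|].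
  by move=> y Xy; rewrite big_ord0 subrr mulr0.
have A1w := fourier_seriesB S0 SD (fourier_series_cst S0 1) (Aw n).
have AwP := fourier_seriesM SD (fourier_seriesM SD (Aw n) (FE n).1) AP.
have AF' := fourier_seriesD S0 AF AwP; have AP' := fourier_seriesM SD AP A1w.
eexists; eexists; eexists; eexists; split; [exact AF'|exact AP'|].
move=> y Xy; have [PE ->] := E y Xy.
split; first by rewrite big_ord_recr /= -PE.
have [->|wn0] := eqVneq (w n y) 0; first by rewrite !mul0r subr0 mulr1 addr0.
have -> : F n y = f y by apply: (FE n).2.
ring.
Qed.

(** Induction on [l]: the windows for its first point cut [X] into finitely many pieces on which
    that point satisfies the requirement, the induction hypothesis deals with the other points on
    each piece, and the results are glued. *)
Lemma fourier_series_on_local (l : seq G) (e : R) X f : 0 < e ->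
  {in l, forall x, S x} -> X `<=` @dual R G ->
  (forall Y, Y `<=` X ->
    {in l, forall x, exists u z, fourier_series S e u /\
      forall y, Y y -> u y = y x - z} ->
    fourier_series_on Y f) ->
  fourier_series_on X f.
Proof.
move=> e0; elim: l X => [|x l IH] X Sl XD H; first exact: H.
have Sx : S x by apply: Sl; rewrite mem_head.
have [n [w [u [z [Aw Au wu w1]]]]] := fourier_series_cover S0 SD SN Sx e0.
apply: (fourier_series_on_glue Aw (n := n)) => [y Xy|i]; first exact/w1/XD.
apply: IH => [x' x'l|y [Xy _]|Y YX Yl].
- by apply: Sl; rewrite in_cons x'l orbT.
- exact: XD.
apply: H => [y /YX[]//|x']; rewrite in_cons => /predU1P[->|]; last exact: Yl.
exists (u i), (z i); split=> // y /YX[Xy wy].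
by apply: wu => //; exact: XD.
Qed.

End Gluing.

(** * Substitution in the local expansions of a real-analytic function *)

Section Composition.
Context {R : realType}.

Lemma square_sum_le_summable (u : nat -> nat -> R) : (forall i j, 0 <= u i j) ->
  summable [set: nat * nat] (fun p => (u p.1 p.2)%:E) ->
  exists B, forall N, square_sum u N <= B.
Proof.
move=> u0 su.
have : (\esum_(p in [set: nat * nat]) `|(u p.1 p.2)%:E| < +oo)%E by [].
under eq_esum do rewrite abse_EFin ger0_norm//.
set T := esum _ _ => Tlty.
have T0 : (0 <= T)%E by apply: esum_ge0 => p _; rewrite lee_fin.
exists (fine T) => N.
rewrite -lee_fin fineK ?ge0_fin_numE// square_sumE -sumEFin.
apply: esum_ge; exists [set` square_seq N].
  by split => //; exact: finite_seq.
by rewrite fsbig_seq// square_seq_uniq.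
Qed.

(** A Lebesgue number argument: an expansion at [z] serves all the [w] near [z] with some margin,
    and compactness, applied to the margins [1 / (n+1)], makes the margin independent of [w]. *)
Lemma real_analytic_uniform (K V : set R[i]) (h : R[i] -> R[i]) :
  compact K -> K `<=` V -> real_analytic V h ->
  exists2 e : R, 0 < e & forall w, K w -> exists z (rho B : R) c,
    [/\ forall N, square_sum (fun i j =>
          normc (c i j) * (rho ^+ i * rho ^+ j)) N <= B,
        forall v, normc (v - z) <= rho ->
          tends (square_sum (fun i j => c i j *
            ((complex.Re (v - z))%:C ^+ i * (complex.Im (v - z))%:C ^+ j))) (h
              v)
      & normc (w - z) + e <= rho].
Proof.
move=> /compact_near_coveringP cptK KV hV.
pose P (n : nat) (w : R[i]) := exists z (rho B : R) c,
    [/\ forall N, square_sum (fun i j =>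
          normc (c i j) * (rho ^+ i * rho ^+ j)) N <= B,
        forall v, normc (v - z) <= rho ->
          tends (square_sum (fun i j => c i j *
            ((complex.Re (v - z))%:C ^+ i * (complex.Im (v - z))%:C ^+ j))) (h
              v)
      & normc (w - z) + n.+1%:R^-1 <= rho].
suff [N _ NK] : \forall n \near \oo, K `<=` P n.
  by exists N.+1%:R^-1 => // w; exact: NK N (leqnn N) w.
apply: cptK => z /KV /hV[r [c [r0 hc]]].
(* The point [z + rho + i rho] is still inside the disc of radius [r]; absolute convergence there is
   the bound on the weighted coefficients. *)
pose rho := r / 2.
have rho0 : 0 < rho by rewrite divr_gt0.
have [B cB] : exists B, forall N, square_sum (fun i j =>
          normc (c i j) * (rho ^+ i * rho ^+ j)) N <= B.
  apply: square_sum_le_summable => [i j|].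
    by rewrite mulr_ge0 ?normc_ge0// mulr_ge0// exprn_ge0// ltW.
  have [] := hc (complex.Re z + rho) (complex.Im z + rho) _.
    by rewrite !(addrC _ rho) !addrK /rho; nra.
  move=> + _; congr (summable _ _); apply/funext => -[i j].
  rewrite !(addrC _ rho) !addrK normr_normc normcM.
  by rewrite normc_real ger0_norm// mulr_ge0// exprn_ge0// ltW.
have Ez : nbhs z [set w | normc (w - z) <= rho / 2].
  apply/nbhs_ballP; exists (rho / 2)%:C; first by rewrite /= ltcR divr_gt0.
  move=> w; rewrite -ball_normE /= normr_normc ltcR normc_distC; exact: ltW.
have En : \forall n \near \oo, n.+1%:R^-1 <= rho / 2.
  exists (Num.bound (rho / 2)^-1) => // n /= Nn.
  have rho2 : 0 < rho / 2 by rewrite divr_gt0.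
  have rho2V : 0 <= (rho / 2)^-1 by rewrite invr_ge0 ltW.
  rewrite invf_ple ?posrE//; apply: le_trans (ltW (archi_boundP rho2V)) _.
  by rewrite ler_nat ltnW// ltnS.
exists ([set w | normc (w - z) <= rho / 2],
  [set n | n.+1%:R^-1 <= rho / 2]) => //=.
move=> [w n] [/= wz nr]; exists z, rho, B, c; split=> //;
  last by rewrite (splitr rho) lerD.
move=> v vz; have [] := hc (complex.Re v) (complex.Im v) _.
  have : normc (v - z) ^+ 2 <= rho ^+ 2.
    by rewrite lerXn2r// nnegrE ?normc_ge0// ltW.
  case: v z {hc Ez wz vz} => [v1 v2] [z1 z2] /=.
  rewrite sqr_sqrtr ?addr_ge0 ?sqr_ge0// /rho; nra.
move=> _ /tends_cvg.
rewrite (_ : complex.Re v +i* complex.Im v = v); last by case: (v).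
apply: tends_ext => N; apply: eq_bigr => i _; apply: eq_bigr => j _.
by rewrite -!rmorphXn -rmorphM; case: v z {hc Ez wz vz} => [v1 v2] [z1 z2].
Qed.

Context {G : topologicalZmodType} (S : set G).
Hypotheses (S0 : S 0) (SD : forall x x', S x -> S x' -> S (x + x'))
  (SN : forall x, S x -> S (- x)).

Lemma fourier_series_bigsum (n : nat) (r : nat -> R)
    (F : nat -> (G -> R[i]) -> R[i]) :
  (forall i, (i < n)%N -> fourier_series S (r i) (F i)) ->
  fourier_series S (\sum_(i < n) r i) (fun y => \sum_(i < n) F i y).
Proof.
elim: n => [_|n IH AF].
  rewrite big_ord0 -(@normc0 R).
  apply: fourier_series_ext (fourier_series_cst S0 0) => y _.
  by rewrite big_ord0.
rewrite big_ord_recr /=.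
have An := fourier_seriesD S0 (IH (fun i (lt_i_n : (i < n)%N) =>
  AF i (ltnW lt_i_n))) (AF n (ltnSn n)).
by apply: fourier_series_ext An => y _; rewrite big_ord_recr.
Qed.

(** On a piece [Y] where the first characters are close to constants in norm, [f] is a constant plus
    an element [v] of norm at most [e / 4]. After recentring at a point [y0] of [Y], the expansion
    that [real_analytic_uniform] gives for [f y0] can be substituted. *)
Lemma fourier_series_comp (K V : set R[i]) (h : R[i] -> R[i]) r f :
  compact K -> K `<=` V -> real_analytic V h ->
  fourier_series S r f ->
  fourier_series_on S [set y | dual y /\ K (f y)] (fun y => h (f y)).
Proof.
move=> cptK KV hV Af.
have [e e0 hE] := real_analytic_uniform cptK KV hV.
have r0 := fourier_series_ge0 Af.
have [a [g [Sg ar af]]] := Af.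
have e8 : 0 < e / 8 by rewrite divr_gt0.
(* All but [e / 8] of the mass is carried by the first [n0] terms; [tau] is the rest. *)
have [n0 an0] : exists N, forall n, (N <= n)%N ->
    \sum_(i < n) normc (a i) <= \sum_(i < N) normc (a i) + e / 8.
  apply: (@bounded_nondecreasing_tail _ (fun n =>
    \sum_(i < n) normc (a i)) r) => //.
  apply/nondecreasing_seqP => n; rewrite big_ord_recr /= lerDl;
    exact: normc_ge0.
pose tau y := f y - \sum_(i < n0) a i * y (g i).
have Atau : fourier_series S (e / 8) tau.
  exists (fun n => a (n0 + n)%N), (fun n => g (n0 + n)%N); split=> // [n|y yD].
    have := an0 (n0 + n)%N (leq_addr _ _).
    by rewrite big_split_ord /= lerD2l.
  have := tendsB (af y yD) (tends_cst (\sum_(i < n0) a i * y (g i))).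
  move=> H d d0; have [N HN] := H d d0; exists N => n Nn.
  have := HN (n0 + n)%N (leq_trans Nn (leq_addl _ _)).
  by rewrite big_split_ord /= [X in normc (X - _)]addrAC subrr add0r.
(* Chosen so that [r * d <= e / 8]; the denominator has [r + 1] since [r] may be 0. *)
pose d := e / (8 * (r + 1)).
have d0 : 0 < d by rewrite divr_gt0// mulr_gt0// ltr_wpDl.
apply: (@fourier_series_on_local _ _ S S0 SD SN [seq g i | i <- iota 0 n0] d) =>
  //.
- by move=> _ /mapP[i _ ->].
- by move=> y [].
move=> Y YX Yl.
have [->|/set0P[y0 Yy0]] := eqVneq Y set0.
  exists (normc (0 : R[i])), (fun=> 0); split=> //.
  exact: fourier_series_cst.
have /choice[u uE] i : exists ui, (i < n0)%N -> fourier_series S d ui /\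
     exists z, forall y, Y y -> ui y = y (g i) - z.
  have [i_n0|] := boolP (i < n0)%N; last by exists (fun=> 0).
  have [] := Yl (g i); first by apply: map_f; rewrite mem_iota.
  by move=> ui [z [Aui uiz]]; exists ui; split=> //; exists z.
have /choice[z zE] i : exists zi, (i < n0)%N ->
    forall y, Y y -> u i y = y (g i) - zi.
  have [/uE[_ [zi ziE]]|] := boolP (i < n0)%N; last by exists 0.
  by exists zi.
pose v y := \sum_(i < n0) a i * u i y + tau y.
have Av : fourier_series S (e / 4) v.
  have := fourier_seriesD S0 (@fourier_series_bigsum n0 (fun i =>
    normc (a i) * d)
    (fun i y => a i * u i y) (fun i i_n0 =>
      fourier_seriesMl S0 SD (a i) (uE i i_n0).1)) Atau.
  apply: fourier_series_le.
  rewrite -mulr_suml.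
  apply: (@le_trans _ _ (r * d + e / 8));
    first by rewrite lerD2r ler_wpM2r// ltW.
  suff : r * d <= e / 8 by lra.
  rewrite /d mulrA ler_pdivrMr ?mulr_gt0// ?ltr_wpDl//.
  have -> : e / 8 * (8 * (r + 1)) = e * (r + 1) by field.
  nra.
pose kappa := \sum_(i < n0) a i * z i.
have fE y : Y y -> f y = kappa + v y.
  move=> Yy; rewrite /v /kappa addrA -big_split /=.
  rewrite (eq_bigr (fun i : 'I_n0 => a i * y (g i))); last first.
    by move=> i _; rewrite zE// -mulrDr addrC subrK.
  by rewrite /tau addrC subrK.
have [y0D Ky0] := YX _ Yy0.
have [z0 [rho [B [c [cB hc rhoE]]]]] := hE _ Ky0.
(* On [Y] this is [f y - z0]. Its norm is at most [e / 4 + e / 4 + normc (f y0 - z0)], hence at most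
   [rho]. *)
pose p y := v y - v y0 + (f y0 - z0).
have Ap : fourier_series S rho p.
  have Ab := fourier_seriesD S0 (fourier_seriesB S0 SD Av (fourier_series_cst S0
    (v y0)))
    (fourier_series_cst S0 (f y0 - z0)).
  apply: fourier_series_le Ab.
  have := fourier_series_normc Av y0D; lra.
exists B, (fun y => h (p y + z0)); split.
  apply: (fourier_series_double_pseries S0 SD (fourier_series_Re S0 SD SN Ap)
    (fourier_series_Im S0 SD SN Ap) cB) => y yD.
  have := hc (p y + z0); rewrite addrK; apply.
  exact: fourier_series_normc Ap yD.
move=> y Yy; congr h.
by rewrite /p !fE//; ring.
Qed.

End Composition.

(** * Integration against a discrete measure *)

Section AtomicMeasure.
Context d (T : measurableType d) (R : realType).

Lemma nneseries_bounded (u : nat -> R) (B : R) : (forall n, 0 <= u n) ->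
  (forall n, \sum_(k < n) u k <= B) ->
  (\sum_(0 <= k <oo) (u k)%:E)%E \is a fin_num /\
  (fun n => \sum_(k < n) u k) @ \oo --> fine (\sum_(0 <= k <oo) (u k)%:E)%E.
Proof.
move=> u0 uB.
have uE n : \sum_(0 <= k < n) u k = \sum_(k < n) u k by rewrite big_mkord.
have cu : cvgn (fun n => \sum_(0 <= k < n) u k).
  apply: nondecreasing_is_cvgn.
    apply/nondecreasing_seqP => n; by rewrite big_nat_recr//= lerDl.
  by exists B => _ [n _ <-]; rewrite uE.
have uoo : (\sum_(0 <= k <oo) (u k)%:E)%E = (limn (fun n =>
  \sum_(0 <= k < n) u k))%:E.
  apply/cvg_lim => //; under eq_fun do rewrite sumEFin.
  by apply: cvg_EFin => //; exact: nearW.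
split; first by rewrite uoo.
rewrite uoo /=; move: cu.
by under [X in X @ _ --> _]eq_fun do rewrite -uE.
Qed.

Section NonnegativeWeights.
Variables (a : nat -> R) (g : nat -> T) (B : R).
Hypotheses (a0 : forall n, 0 <= a n) (aB : forall n, \sum_(k < n) a k <= B).

Definition atomic_measure : {measure set T -> \bar R} :=
  mseries (fun n => mscale (NngNum (a0 n)) \d_(g n)) 0.

Let sum_le (f : T -> R) (M : R) : (forall x, 0 <= f x <= M) ->
  forall n, \sum_(k < n) a k * f (g k) <= M * B.
Proof.
move=> fM n; have /andP[f0 fM0] := fM (g 0%N).
have M0 : 0 <= M := le_trans f0 fM0.
apply: (@le_trans _ _ (\sum_(k < n) M * a k)).
  by apply: ler_sum => k _; rewrite mulrC ler_wpM2r//; have /andP[] := fM (g k).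
by rewrite -mulr_sumr ler_wpM2l.
Qed.

Lemma integral_atomic_measure (f : T -> R) (M : R) :
  measurable_fun [set: T] f -> (forall x, 0 <= f x <= M) ->
  (\int[atomic_measure]_x (f x)%:E)%E \is a fin_num /\
  (fun n => \sum_(k < n) a k * f (g k)) @ \oo -->
    fine (\int[atomic_measure]_x (f x)%:E)%E.
Proof.
move=> mf fM.
have -> : (\int[atomic_measure]_x (f x)%:E)%E =
    (\sum_(0 <= k <oo) (a k * f (g k))%:E)%E.
  rewrite ge0_integral_measure_series//; last 2 first.
  - by move=> x _; rewrite lee_fin; have /andP[] := fM x.
  - exact/measurable_EFinP.
  apply: eq_eseriesr => k _.
  rewrite ge0_integral_mscale//; last 2 first.
  - exact/measurable_EFinP.
  - by move=> x _; rewrite lee_fin; have /andP[] := fM x.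
  rewrite integral_dirac//; last exact/measurable_EFinP.
  by rewrite diracT mul1e EFinM.
apply: nneseries_bounded (sum_le fM) => n.
by rewrite mulr_ge0//; have /andP[] := fM (g n).
Qed.

Lemma atomic_measureE (A : set T) :
  atomic_measure A \is a fin_num /\
  (fun n => \sum_(k < n) a k * \1_A (g k)) @ \oo --> fine (atomic_measure A).
Proof.
have -> : atomic_measure A = (\sum_(0 <= k <oo) (a k * \1_A (g k))%:E)%E.
  by apply: eq_eseriesr => k _; rewrite EFinM.
have A1 x : 0 <= (\1_A x : R) <= 1 by rewrite indicE ler0n lern1 leq_b1.
apply: (@nneseries_bounded (fun k => a k * \1_A (g k)) (1 * B)) => n.
  by rewrite mulr_ge0//; have /andP[] := A1 (g n).
exact: (sum_le A1 n).
Qed.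

End NonnegativeWeights.

Section SignedWeights.
Variables (a : nat -> R) (g : nat -> T) (B : R).
Hypothesis aB : forall n, \sum_(k < n) `|a k| <= B.

Let p k := Num.max (a k) 0.
Let q k := Num.max (- a k) 0.

Let p0 k : 0 <= p k. Proof. by rewrite /p le_max lexx orbT. Qed.
Let q0 k : 0 <= q k. Proof. by rewrite /q le_max lexx orbT. Qed.

Let pq k : a k = p k - q k.
Proof. by rewrite /p /q; case: (leP (a k) 0); case: (leP (- a k) 0); lra. Qed.

Let pB n : \sum_(k < n) p k <= B.
Proof.
apply: le_trans (aB n); apply: ler_sum => k _.
by rewrite /p ge_max ler_norm normr_ge0.
Qed.

Let qB n : \sum_(k < n) q k <= B.
Proof.
apply: le_trans (aB n); apply: ler_sum => k _.
by rewrite /q ge_max -normrN ler_norm normr_ge0.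
Qed.

Let sumE (f : T -> R) n : \sum_(k < n) a k * f (g k) =
  \sum_(k < n) p k * f (g k) - \sum_(k < n) q k * f (g k).
Proof. by rewrite -sumrB; apply: eq_bigr => k _; rewrite pq mulrBl. Qed.

Let mp : set T -> \bar R := atomic_measure g p0.
Let mq : set T -> \bar R := atomic_measure g q0.

Let mp_fin : fin_num_fun mp.
Proof. by move=> A _; have [] := atomic_measureE g p0 pB A. Qed.
Let mq_fin : fin_num_fun mq.
Proof. by move=> A _; have [] := atomic_measureE g q0 qB A. Qed.

HB.instance Definition _ := Measure.copy mp (atomic_measure g p0).
HB.instance Definition _ := @Measure_isFinite.Build _ _ _ mp mp_fin.
HB.instance Definition _ := Measure.copy mq (atomic_measure g q0).
HB.instance Definition _ := @Measure_isFinite.Build _ _ _ mq mq_fin.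

Lemma atomic_charge : exists nu : {charge set T -> \bar R}, forall A : set T,
  (fun n => \sum_(k < n) a k * \1_A (g k)) @ \oo --> fine (nu A).
Proof.
exists (cadd (charge_of_finite_measure mp) (copp (charge_of_finite_measure
  mq))).
move=> A; have [pA cp] := atomic_measureE g p0 pB A.
have [qA cq] := atomic_measureE g q0 qB A.
rewrite /cadd /copp /charge_of_finite_measure /= fineD ?fin_numN// fineN.
under [X in X @ _ --> _]eq_fun do rewrite sumE.
exact: cvgB.
Qed.

Variable nu : {charge set T -> \bar R}.
Hypothesis nuE : forall A, measurable A ->
  (fun n => \sum_(k < n) a k * \1_A (g k)) @ \oo --> fine (nu A).

Let jp := jordan_pos (hahn_pos_neg nu).
Let jn := jordan_neg (hahn_pos_neg nu).

(** Both [jp - jn] and [mp - mq] are [nu] on measurable sets. As atoms with opposite weights may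
    coincide, [mp] and [mq] can differ from the Jordan parts; written with sums, the identity is one
    between measures and can be integrated. *)
Let jordan_balance A : measurable A ->
  measure_add jp mq A = measure_add jn mp A.
Proof.
move=> mA; rewrite !measure_addE.
have [pA cp] := atomic_measureE g p0 pB A.
have [qA cq] := atomic_measureE g q0 qB A.
have := nuE mA; under [X in X @ _ --> _]eq_fun do rewrite sumE.
move=> /(cvg_unique _ (cvgB cp cq)) => /(_ (@norm_hausdorff _ _)) E.
have jpf : jp A \is a fin_num by exact: fin_num_measure.
have jnf : jn A \is a fin_num by exact: fin_num_measure.
have nuA : nu A = (jp A - jn A)%E.
  rewrite (jordan_decomp (hahn_pos_neg nu) mA) /cadd /=; congr (_ + _)%E.
  by rewrite cscaleN1.
move: E; rewrite nuA fineD ?fin_numN// fineN => E.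
change (jp A + mq A = jn A + mp A)%E.
rewrite -(fineK jpf) -(fineK jnf) -(fineK (pA : mp A \is a fin_num)).
rewrite -(fineK (qA : mq A \is a fin_num)) -!EFinD; congr EFin.
by move: E; rewrite -/(mp A) -/(mq A); lra.
Qed.

Let integrable_bounded (m : {finite_measure set T -> \bar R}) (f : T ->
  R) (M : R) :
  measurable_fun [set: T] f -> (forall x, `|f x| <= M) ->
  m.-integrable [set: T] (EFin \o f).
Proof.
move=> mf fM; apply: measurable_bounded_integrable => //.
  by rewrite ltey_eq fin_num_measure.
exists M; split; first exact: num_real.
by move=> x Mx y _; exact: le_trans (fM y) (ltW Mx).
Qed.

Let charge_integral_nneg (f : T -> R) (M : R) :
  measurable_fun [set: T] f -> (forall x, 0 <= f x <= M) ->
  (fun n => \sum_(k < n) a k * f (g k)) @ \oo --> charge_integral nu f.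
Proof.
move=> mf fM.
have f0 x : [set: T] x -> (0 <= (f x)%:E)%E.
  by move=> _; rewrite lee_fin; have /andP[] := fM x.
have mfE : measurable_fun [set: T] (EFin \o f) by exact/measurable_EFinP.
have fM' x : `|f x| <= M by have /andP[? ?] := fM x; rewrite ger0_norm.
have [pf cp] : (\int[mp]_x (f x)%:E)%E \is a fin_num /\
    (fun n => \sum_(k < n) p k * f (g k)) @ \oo --> fine (\int[mp]_x (f
      x)%:E)%E.
  exact: integral_atomic_measure mf fM.
have [qf cq] : (\int[mq]_x (f x)%:E)%E \is a fin_num /\
    (fun n => \sum_(k < n) q k * f (g k)) @ \oo --> fine (\int[mq]_x (f
      x)%:E)%E.
  exact: integral_atomic_measure mf fM.
have jpf : (\int[jp]_x (f x)%:E)%E \is a fin_num.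
  by apply: integrable_fin_num => //; exact: integrable_bounded mf fM'.
have jnf : (\int[jn]_x (f x)%:E)%E \is a fin_num.
  by apply: integrable_fin_num => //; exact: integrable_bounded mf fM'.
have : (\int[measure_add jp mq]_x (f x)%:E = \int[measure_add jn mp]_x (f
  x)%:E)%E.
  by apply: eq_measure_integral => A mA _; exact: jordan_balance.
rewrite !ge0_integral_measure_add// => /(congr1 fine).
rewrite (fineD jpf qf) (fineD jnf pf) => E.
rewrite /charge_integral /Rintegral -/jp -/jn.
rewrite (_ : _ - _ = fine (\int[mp]_x (f x)%:E)%E - fine (\int[mq]_x (f
  x)%:E)%E).
  under [X in X @ _ --> _]eq_fun do rewrite sumE.
  exact: cvgB.
by move: E; rewrite -/jp -/jn; lra.
Qed.

(** Adding [M] makes the integrand nonnegative; the constant is then removed by linearity. *)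
Lemma charge_integral_atomic (f : T -> R) (M : R) :
  measurable_fun [set: T] f -> (forall x, `|f x| <= M) ->
  (fun n => \sum_(k < n) a k * f (g k)) @ \oo --> charge_integral nu f.
Proof.
move=> mf fM.
have M0 : 0 <= M := le_trans (normr_ge0 _) (fM (g 0%N)).
have fM2 x : 0 <= f x + M <= M + M.
  by have := fM x; rewrite ler_norml => /andP[? ?]; apply/andP; split; lra.
have mM : measurable_fun [set: T] (fun=> M : R) by exact: measurable_cst.
have mfM : measurable_fun [set: T] (fun x => f x + M) by exact: measurable_funD.
have c1 := charge_integral_nneg mfM fM2.
have c2 : (fun n => \sum_(k < n) a k * M) @ \oo --> charge_integral nu (fun=>
  M).
  by apply: (@charge_integral_nneg _ M) => // x; rewrite M0 lexx.
have -> : charge_integral nu f =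
    charge_integral nu (fun x => f x + M) - charge_integral nu (fun=> M).
  have MM : forall x : T, `|M| <= M by move=> _; rewrite ger0_norm.
  have RD (m : {finite_measure set T -> \bar R}) :
      \int[m]_x (f x + M) = \int[m]_x f x + \int[m]_x M.
    apply: RintegralD => //; first exact: integrable_bounded mf fM.
    exact: integrable_bounded mM MM.
  by rewrite /charge_integral (RD (jordan_pos _)) (RD (jordan_neg _)); ring.
rewrite [X in X @ _ --> _](_ : _ = (fun n => \sum_(k < n) a k * (f (g k) + M) -
    \sum_(k < n) a k * M)); first exact: cvgB.
apply/funext => n; rewrite -sumrB; apply: eq_bigr => k _; ring.
Qed.

End SignedWeights.
End AtomicMeasure.

(** * Discrete complex measures and their Fourier transforms *)

Section LinZ.
Context (G : zmodType) (E : set G).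

Lemma LinZ0 : LinZ E 0.
Proof.
by exists 0%N, (fun=> 0), (fun=> 0); split=> [[]//|]; rewrite big_ord0.
Qed.

Lemma LinZD x x' : LinZ E x -> LinZ E x' -> LinZ E (x + x').
Proof.
move=> [n [c [e [Ee ->]]]] [n' [c' [e' [Ee' ->]]]].
pose glue X (f : 'I_n -> X) (f' : 'I_n' -> X) (i : 'I_(n + n')) :=
  match fintype.split i with inl j => f j | inr j => f' j end.
exists (n + n')%N, (glue _ c c'), (glue _ e e'); split.
  by move=> i; rewrite /glue; case: fintype.split.
rewrite big_split_ord /glue; congr (_ + _); apply: eq_bigr => i _.
  by rewrite (unsplitK (inl i)).
by rewrite (unsplitK (inr i)).
Qed.

Lemma LinZN x : LinZ E x -> LinZ E (- x).
Proof.
move=> [n [c [e [Ee ->]]]]; exists n, (fun i => - c i), e; split=> //.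
by rewrite -sumrN; apply: eq_bigr => i _; rewrite mulrNz.
Qed.

Lemma sub_LinZ : E `<=` LinZ E.
Proof.
by move=> x Ex; exists 1%N, (fun=> 1), (fun=> x); split=> //;
  rewrite big_ord1 mulr1z.
Qed.

End LinZ.

Section ReIm.
Context {R : realType}.
Implicit Types (u : nat -> R[i]) (s : R[i]).

Lemma tends_Re u s : tends u s ->
  (fun n => complex.Re (u n)) @ \oo --> complex.Re s.
Proof.
move=> us; apply/cvgrPdist_le => e /us[N Nu]; exists N => // n /Nu.
by apply: le_trans; rewrite distrC -raddfB; exact: normc_Re.
Qed.

Lemma tends_Im u s : tends u s ->
  (fun n => complex.Im (u n)) @ \oo --> complex.Im s.
Proof.
move=> us; apply/cvgrPdist_le => e /us[N Nu]; exists N => // n /Nu.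
by apply: le_trans; rewrite distrC -raddfB; exact: normc_Im.
Qed.

Lemma tends_ReIm (u v : nat -> R) (s t : R) :
  u @ \oo --> s -> v @ \oo --> t -> tends (fun n => u n +i* v n) (s +i* t).
Proof.
move=> us vt; rewrite [s +i* t]complexE.
apply: tends_ext (tendsD (tends_real us) (tendsMl 'i (tends_real vt))) => n.
by rewrite [RHS]complexE.
Qed.

Lemma Re_sum n (F : 'I_n -> R[i]) :
  complex.Re (\sum_(k < n) F k) = \sum_(k < n) complex.Re (F k).
Proof. by elim/big_rec2: _ => // i x z _ <-; case: (F i) z => ? ? []. Qed.

Lemma Im_sum n (F : 'I_n -> R[i]) :
  complex.Im (\sum_(k < n) F k) = \sum_(k < n) complex.Im (F k).
Proof. by elim/big_rec2: _ => // i x z _ <-; case: (F i) z => ? ? []. Qed.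

End ReIm.

Section AtomicFourier.
Context {R : realType} {G : topologicalZmodType}.
Implicit Types (mu : complex_measure (borel G) R) (y : G -> R[i]).

Definition is_atomic mu (a : nat -> R[i]) (g : nat -> G) (B : R) :=
  (forall n, \sum_(k < n) normc (a k) <= B) /\
  forall A : set (borel G), measurable A ->
    tends (fun n => \sum_(k < n) a k * \1_A (g k)) (cmeas mu A).

Lemma M_dP mu : M_d mu <-> exists a g B, is_atomic mu a g B.
Proof.
have seriesE (W : zmodType) (u : nat -> W) : series u = (fun n =>
  \sum_(k < n) u k).
  by apply/funext => n; rewrite /series /= big_mkord.
have normedE a : [normed series a] = fun n => (\sum_(k < n) normc (a k))%:C.
  rewrite /normed_series_of seriesE; apply/funext => n.
  by rewrite rmorph_sum; apply: eq_bigr => k _; exact: normr_normc.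
split=> [[a [g [ca muE]]]|[a [g [B [aB muE]]]]]; exists a, g.
  move/cvg_ex: ca => [l /tends_cvg al]; have [N aN] := al 1 ltr01.
  (* The partial sums of the norms are nondecreasing, and within 1 of their limit [l] from [N]
     on. *)
  exists (normc l + 1); split=> [n|A mA]; last first.
    by have /tends_cvg := muE A mA; rewrite seriesE.
  have := aN (maxn N n) (leq_maxl _ _); rewrite normedE => H.
  apply: (@le_trans _ _ (\sum_(k < maxn N n) normc (a k))).
    rewrite -!(big_mkord predT (fun k => normc (a k))).
    rewrite [leRHS](@big_cat_nat _ _ _ n)//= ?leq_maxr// lerDl.
    by apply: sumr_ge0 => k _; exact: normc_ge0.
  have := le_trans (ler_normcD (_ - l) l) (lerD H (lexx _)).
  rewrite subrK normc_real ger0_norm; last by apply: sumr_ge0 => k _;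
    exact: normc_ge0.
  by rewrite addrC.
split=> [|A mA]; last by apply/tends_cvg; rewrite seriesE; exact: muE.
have : cvgn (fun n => \sum_(k < n) normc (a k)).
  apply: nondecreasing_is_cvgn.
    by apply/nondecreasing_seqP => n; rewrite big_ord_recr /= lerDl normc_ge0.
  by exists B => _ [n _ <-].
move=> /cvg_ex[l /tends_real/tends_cvg al]; apply/cvg_ex; exists l%:C.
by rewrite normedE.
Qed.

(** The second conclusion holds for arbitrary sets, which gives the mass of singletons directly. *)
Lemma atomic_complex_measure (a : nat -> R[i]) (g : nat -> G) (B : R) :
  (forall n, \sum_(k < n) normc (a k) <= B) ->
  exists2 nu, is_atomic nu a g B & forall A : set (borel G),
    tends (fun n => \sum_(k < n) a k * \1_A (g k)) (cmeas nu A).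
Proof.
move=> aB.
have ReB n : \sum_(k < n) `|complex.Re (a k)| <= B.
  by apply: le_trans (aB n); apply: ler_sum => k _; exact: normc_Re.
have ImB n : \sum_(k < n) `|complex.Im (a k)| <= B.
  by apply: le_trans (aB n); apply: ler_sum => k _; exact: normc_Im.
have [re reE] := @atomic_charge _ (borel G) R (fun k =>
  complex.Re (a k)) g B ReB.
have [im imE] := @atomic_charge _ (borel G) R (fun k =>
  complex.Im (a k)) g B ImB.
have nuE A : tends (fun n => \sum_(k < n) a k * \1_A (g k))
    (cmeas (ComplexMeasure re im) A).
  apply: tends_ext (tends_ReIm (reE A) (imE A)) => n.
  apply/eqP; rewrite eq_complex Re_sum Im_sum /=.
  apply/andP; split; apply/eqP; apply: eq_bigr => k _; case: (a k) => p q;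
    rewrite !indicE; case: (_ \in _) => /=; ring.
by exists (ComplexMeasure re im).
Qed.

Lemma continuous_borel_measurable (f : G -> R) : continuous f ->
  measurable_fun [set: borel G] (f : borel G -> R).
Proof.
move=> cf; apply: (measurability _ (RGenOInfty.measurableE R)).
move=> _ [_ [x ->] <-]; rewrite setTI; apply: sub_sigma_algebra.
have /continuousP := cf; apply; exact: interval_open.
Qed.

Lemma continuous_Re y : continuous y -> continuous (fun x => complex.Re (y x)).
Proof.
move=> cy x; apply/cvgrPdist_le => e e0.
have eC : 0 < e%:C by rewrite ltcR.
have /cvgrPdist_le/(_ _ eC) := cy x; apply: filterS => x'.
rewrite normr_normc lecR; apply: le_trans; rewrite -raddfB; exact: normc_Re.
Qed.

Lemma continuous_Im y : continuous y -> continuous (fun x => complex.Im (y x)).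
Proof.
move=> cy x; apply/cvgrPdist_le => e e0.
have eC : 0 < e%:C by rewrite ltcR.
have /cvgrPdist_le/(_ _ eC) := cy x; apply: filterS => x'.
rewrite normr_normc lecR; apply: le_trans; rewrite -raddfB; exact: normc_Im.
Qed.

Lemma tends_fourier mu a g B y : is_atomic mu a g B -> dual y ->
  tends (fun n => \sum_(k < n) a k * y (- g k)) (fourier mu y).
Proof.
move=> [aB muE] yD; have cy : continuous y by case: yD.
have ReB n : \sum_(k < n) `|complex.Re (a k)| <= B.
  by apply: le_trans (aB n); apply: ler_sum => k _; exact: normc_Re.
have ImB n : \sum_(k < n) `|complex.Im (a k)| <= B.
  by apply: le_trans (aB n); apply: ler_sum => k _; exact: normc_Im.
have reE (A : set (borel G)) : measurable A ->
    (fun n => \sum_(k < n) complex.Re (a k) * \1_A (g k)) @ \oo -->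
    fine (re_charge mu A).
  move=> /muE/tends_Re; rewrite (_ : (fun n => complex.Re _) =
    fun n => \sum_(k < n) complex.Re (a k) * \1_A (g k))//.
  apply/funext => n; rewrite Re_sum; apply: eq_bigr => k _.
  by case: (a k) => p q; rewrite !indicE; case: (_ \in _) => /=; ring.
have imE (A : set (borel G)) : measurable A ->
    (fun n => \sum_(k < n) complex.Im (a k) * \1_A (g k)) @ \oo -->
    fine (im_charge mu A).
  move=> /muE/tends_Im; rewrite (_ : (fun n => complex.Im _) =
    fun n => \sum_(k < n) complex.Im (a k) * \1_A (g k))//.
  apply/funext => n; rewrite Im_sum; apply: eq_bigr => k _.
  by case: (a k) => p q; rewrite !indicE; case: (_ \in _) => /=; ring.
have mRe : measurable_fun [set: borel G] (fun x : borel G =>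
  complex.Re (y (- x))).
  apply: continuous_borel_measurable.
  (* On the dual, [y (- x)] is the conjugate of [y x], so its real and imaginary parts inherit the
     continuity of [y]. *)
  rewrite (_ : (fun _ => _) = fun x => complex.Re (y x));
    first exact: continuous_Re.
  by apply/funext => x; rewrite dualN//; case: (y x).
have mIm : measurable_fun [set: borel G] (fun x : borel G =>
  complex.Im (y (- x))).
  apply: continuous_borel_measurable.
  rewrite (_ : (fun _ => _) = fun x => - complex.Im (y x)).
    by move=> x; apply: cvgN; exact: continuous_Im.
  by apply/funext => x; rewrite dualN//; case: (y x).
have Re1 (x : borel G) : `|complex.Re (y (- x))| <= 1.
  by rewrite -(dual_normc (- x) yD) normc_Re.
have Im1 (x : borel G) : `|complex.Im (y (- x))| <= 1.
  by rewrite -(dual_normc (- x) yD) normc_Im.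
have rr := @charge_integral_atomic _ (borel G) R (fun k =>
  complex.Re (a k)) g B ReB _ reE _ _ mRe Re1.
have ri := @charge_integral_atomic _ (borel G) R (fun k =>
  complex.Re (a k)) g B ReB _ reE _ _ mIm Im1.
have ir := @charge_integral_atomic _ (borel G) R (fun k =>
  complex.Im (a k)) g B ImB _ imE _ _ mRe Re1.
have ii := @charge_integral_atomic _ (borel G) R (fun k =>
  complex.Im (a k)) g B ImB _ imE _ _ mIm Im1.
apply: tends_ext (tends_ReIm (cvgB rr ii) (cvgD ri ir)) => n.
apply/eqP; rewrite eq_complex Re_sum Im_sum /=.
rewrite !fctE -sumrB -big_split /=; apply/andP; split; apply/eqP;
  apply: eq_bigr => k _.
  by case: (a k) (y (- g k)) => [p q] [p' q'].
by case: (a k) (y (- g k)) => [p q] [p' q'] /=; rewrite addrC.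
Qed.

(* Regrouping the terms of the series by atoms makes those lying outside of
   [supp mu] disappear. *)
Lemma fourier_series_fourier mu a g B : hausdorff_space G ->
  is_atomic mu a g B -> fourier_series (LinZ (supp mu)) B (fourier mu).
Proof.
move=> hG amu; have [aB muE] := amu.
(* [first] selects the least index of each atom; [c i j] says that [i] is the one selected for the
   atom [g j]. By [sum_c], each [j] has exactly one such [i], and it is at most [j]. *)
pose first i := g i \notin [seq g k | k <- iota 0 i].
pose c i j := first i && (g j == g i).
have sum_c N (j : 'I_N) (V : nmodType) (x : V) :
    \sum_(i < N) (if c i j then x else 0) = x.
  have [i0 /eqP gi0 min_i0] :=
    @ex_minnP (fun i => g i == g j) (ex_intro _ (val j) (eqxx _)).
  have i0N : (i0 < N)%N by rewrite (leq_ltn_trans (min_i0 _ (eqxx (g j)))).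
  rewrite (bigD1 (Ordinal i0N))//= ifT; last first.
    rewrite /c gi0 eqxx andbT; apply/negP => /mapP[k];
      rewrite mem_iota add0n => /= ki0 gk.
    by have := min_i0 k; rewrite -gk gi0 eqxx leqNgt ki0 => /(_ isT).
  rewrite big1 ?addr0// => i ni0; case: ifPn => // /andP[fi /eqP gij].
  have ii0 : i0 != i :> nat.
    by apply: contra ni0 => /eqP ii0; apply/eqP/val_inj.
  have i0i : (i0 < i)%N by rewrite ltn_neqAle ii0 min_i0 ?gij.
  case/negP: fi; apply/mapP; exists i0; last by rewrite gi0.
  by rewrite mem_iota add0n.
pose u i j := if c i j then a j else 0.
have normu i j : normc (u i j) = if c i j then normc (a j) else 0.
  by rewrite /u; case: ifP => // _; rewrite normc0.
have uB N : square_sum (fun i j => normc (u i j)) N <= B.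
  rewrite /square_sum exchange_big /=; apply: le_trans (aB N).
  apply: ler_sum => j _.
  by under eq_bigr do rewrite normu; rewrite sum_c.
(* The sum of row [i] of [u]: the total weight of the atom, which is nonzero only if [g i] is in
   [supp mu]. *)
pose a' i := if first i then cmeas mu [set g i] else 0.
have m1 x : measurable ([set x] : set (borel G)).
  rewrite -[X in measurable X]setCK; apply: measurableC;
    apply: sub_sigma_algebra.
  apply: closed_openC; apply: accessible_closed_set1.
  exact: hausdorff_accessible.
have ua' i : tends (fun n => \sum_(j < n) u i j) (a' i).
  rewrite /a' /u /c; case: ifP => fi; last first.
    by apply: tends_ext (tends_cst 0) => n; rewrite big1.
  apply: tends_ext (muE _ (m1 (g i))) => n; apply: eq_bigr => j _ /=.
  have -> : \1_[set g i] (g j) = (g j == g i)%:R :> R[i].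
    by rewrite indicE; congr (nat_of_bool _)%:R; apply/idP/eqP; rewrite inE.
  by case: eqP => _; rewrite ?mulr1 ?mulr0.
(* Where the coefficient vanishes, the point is replaced by 0, which belongs to [LinZ (supp mu)]. *)
exists a', (fun i => if a' i == 0 then 0 else - g i); split.
- move=> i; case: ifPn => [_|]; first exact: LinZ0.
  rewrite /a'; case: ifP => [_ mi|]; last by rewrite eqxx.
  exact/LinZN/sub_LinZ.
- exact: (@rows_normc_le _ u B uB a' ua').
move=> y yD.
apply: (@tends_ext _ (fun n => \sum_(i < n) a' i * y (- g i))).
  by move=> n; apply: eq_bigr => i _; case: eqP => // ->; rewrite !mul0r.
have vB N : square_sum (fun i j => normc (u i j * y (- g j))) N <= B.
  rewrite (le_trans _ (uB N))//; apply: ler_sum => i _; apply: ler_sum => j _.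
  by rewrite normcM dual_normc// mulr1.
have va' i : tends (fun n => \sum_(j < n) u i j * y (- g j)) (a' i * y (- g i)).
  rewrite mulrC; apply: tends_ext (tendsMl (y (- g i)) (ua' i)) => n.
  rewrite mulr_sumr; apply: eq_bigr => j _; rewrite mulrC /u /c.
  by case: ifP => [/andP[_ /eqP ->]//|]; rewrite !mul0r.
apply/(@tends_square_rows _ (fun i j => u i j * y (- g j)) B vB _ va').
apply: tends_ext (tends_fourier amu yD) => n.
rewrite /square_sum exchange_big /=; apply: eq_bigr => j _.
by rewrite -mulr_suml /u sum_c.
Qed.

End AtomicFourier.

Theorem theorem5 (R : realType) (G : topologicalZmodType)
    (hausG : hausdorff_space G) (lcG : locally_compact [set: G])
    (mu : complex_measure (borel G) R) (Mmu : M_d mu)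
    (K : set R[i]) (cptK : compact K)
    (V : set R[i]) (h : R[i] -> R[i])
    (oV : open V) (KV : K `<=` V) (hV : real_analytic V h) :
  exists nu : complex_measure (borel G) R,
    [/\ M_d nu,
        forall y : G -> R[i], dual y -> K (fourier mu y) ->
          fourier nu y = h (fourier mu y)
      & supp nu `<=` LinZ (supp mu)].
Proof.
have /M_dP[a [g [B amu]]] := Mmu.
have S0 := @LinZ0 _ (supp mu).
have SD := @LinZD _ (supp mu).
have SN := @LinZN _ (supp mu).
have Amu := fourier_series_fourier hausG amu.
have [r [F [[b [x [Sx br bF]]] FE]]] :=
  fourier_series_comp S0 SD SN cptK KV hV Amu.
(* The transform evaluates [y] at the opposites of the atoms, so the atoms are placed at the
   [- x n]. *)
have [nu anu nuE] := @atomic_complex_measure _ _ b (fun n => - x n) r br.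
exists nu; split.
- by apply/M_dP; exists b, (fun n => - x n), r.
- move=> y yD Ky; rewrite -FE//.
  apply: tends_uniq (bF y yD); apply: tends_ext (tends_fourier anu yD) => n.
  by apply: eq_bigr => k _; rewrite opprK.
(* If [z] is outside of the subgroup, no atom is equal to [z], and all the partial sums for the mass
   of [z] are 0. *)
move=> z; rewrite /supp /= => nuz; apply: contrapT => nSz.
case/eqP: nuz; apply: tends_uniq (nuE _) _.
apply: tends_ext (tends_cst 0) => n; rewrite big1// => k _.
rewrite indicE memNset ?mulr0// => /= zE.
by apply: nSz; rewrite -zE; exact: SN.
Qed.
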